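(* Let $G$ be a finite group and let $\sigma\in\mathrm{Z}^2_L(DG^* )$ be a lazy $2$-cocycle such that $\beta_\sigma$ is cohomologically trivial in $\mathrm{H}^2(G,k^\times)$, $\alpha_\sigma$ is cohomologically trivial in $\mathrm{H}^2(k^G)$, and $\lambda_\sigma(g,e_x)=\epsilon(e_x)$ for all $g,x\in G$. Then $\sigma$ is cohomologically trivial in $\mathrm{H}^2(DG^* )$, i.e. $\sigma=\mathrm{d}\mu$ for some $\mu\in\mathrm{Reg}^1(DG^* )$; but $\sigma$ is not necessarily cohomologically trivial in $\mathrm{H}^2_L(DG^* )$ (that is, there exist a finite group $G$ and such a $\sigma$ which is not of the form $\mathrm{d}\mu$ with $\mu\in\mathrm{Reg}^1_L(DG^* )$).
   Context: $k$ is an algebraically closed field of characteristic zero, $G$ a finite group, $k^G$ the algebra of functions on $G$ with basis $e_x$, $e_x(y)=\delta_{x,y}$, with its usual Hopf algebra structure ($\Delta(e_x)=\sum_{x_1x_2=x}e_{x_1}\otimes e_{x_2}$, $\epsilon(e_x)=\delta_{x,1}$). Sweedler notation $\Delta(a)=a_1\otimes a_2$ is used. $DG^*$, the dual of the Drinfeld double, is the Hopf algebra with basis $x\times e_y$ ($x,y\in G$), product $(x\times e_y)(x'\times e_{y'})=xx'\times e_ye_{y'}$ (pointwise product in $k^G$), coproduct $\Delta(x\times e_y)=\sum_{y_1y_2=y}(x\times e_{y_1})\otimes(y_1^{-1}xy_1\times e_{y_2})$, counit $\epsilon(x\times e_y)=\delta_{y,1}$. In $g\times 1$ the symbol $1$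 is $1_{k^G}=\sum_xe_x$; for $f\in k^G$, $1\times f$ has $1=1_G$. For a Hopf algebra $H$: $\mathrm{Reg}^1(H)$ is the group of convolution invertible linear maps $\eta:H\to k$ with $\eta(1)=1$; $\mathrm{Reg}^2(H)$ is the group of convolution invertible linear maps $\sigma:H\otimes H\to k$ with $\sigma(1,h)=\epsilon(h)=\sigma(h,1)$. $\mathrm{Z}^2(H)$ is the set of $2$-cocycles: $\sigma\in\mathrm{Reg}^2(H)$ with $\sigma(a_1,b_1)\sigma(a_2b_2,c)=\sigma(b_1,c_1)\sigma(a,b_2c_2)$. For $\eta\in\mathrm{Reg}^1(H)$, $\mathrm{d}\eta(a,b)=\eta(a_1)\eta(b_1)\eta^{-1}(a_2b_2)$. A $2$-cocycle is cohomologically trivial in $\mathrm{H}^2(H)$ if it equals $\mathrm{d}\eta$ for some $\eta\in\mathrm{Reg}^1(H)$. $\eta\in\mathrm{Reg}^1(H)$ is lazy if $\eta(h_1)h_2=h_1\eta(h_2)$ for all $h$ (subgroup $\mathrm{Reg}^1_L(H)$). $\sigma\in\mathrm{Reg}^2(H)$ is lazy if $\sigma(a_1,b_1)a_2b_2=a_1b_1\sigma(a_2,b_2)$ for all $a,b$; $\mathrm{Z}^2_L(H)$ is the group (under convolution) of lazy $2$-cocycles, and $\mathrm{H}^2_L(H)=\mathrm{Z}^2_L(H)/\mathrm{d}(\mathrm{Reg}^1_L(H))$. For $\sigma\in\mathrm{Z}^2_L(DG^* )$, with convolution inverse $\sigma^{-1}$, define $\beta_\sigma(g,h)=\sigma(g\times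 1,h\times 1)$, which is a $2$-cocycle of $G$ with values in $k^\times$; $\alpha_\sigma(e_x,e_y)=\sigma(1\times e_x,1\times e_y)$, which is a $2$-cocycle on $k^G$; $\lambda_\sigma(g,f)=\sigma^{-1}((1\times f)_1,(g\times1)_1)\,\sigma((g\times 1)_2,(1\times f)_2)=\sum_{t,x,y\in G}f(xy)\,\sigma^{-1}(1\times e_x,g\times e_t)\,\sigma(t^{-1}gt\times1,1\times e_y)$ for $g\in G$, $f\in k^G$. *)

(* Defs.v *)
From HB Require Import structures.
From mathcomp Require Import all_boot all_order all_algebra all_fingroup.
From mathcomp Require Import sesquilinear.

Set Implicit Arguments.
Unset Strict Implicit.
Unset Printing Implicit Defensive.

Import GRing.Theory.
Local Open Scope ring_scope.

(* An element of U (x) U is represented by a finite list of pure tensors.     *)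
(* Such a representation is not unique, but the sum below depends only on the *)
(* tensor as soon as E is bilinear in a1 and a2, as it is in all uses.        *)
Definition sweedler (U : Type) (V : nmodType) (s : seq (U * U))
  (F : U -> U -> V) : V := \sum_(p <- s) F p.1 p.2.

Reserved Notation "\sw_ ( a1 , a2 <- s ) E"
  (at level 34, E at level 36, a1 name, a2 name, s at level 50,
   format "\sw_ ( a1 ,  a2  <-  s )  E").
Notation "\sw_ ( a1 , a2 <- s ) E" := (sweedler s (fun a1 a2 => E))
  : ring_scope.

Definition biscalar_map (k : fieldType) (U : lmodType k) (F : U -> U -> k) :=
  (forall v, scalar (F^~ v)) /\ (forall u, scalar (F u)).

Definition triscalar_map (k : fieldType) (U : lmodType k)
    (F : U -> U -> U -> k) :=
  [/\ forall v w, scalar (fun u => F u v w),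
      forall u w, scalar (fun v => F u v w)
    & forall u v, scalar (F u v)].

(* Over a field, two elements of a tensor power of H are equal if and only if *)
(* every multilinear form takes the same value on both; linearity,            *)
(* coassociativity and multiplicativity of the coproduct are stated that way. *)
HB.mixin Record isHopf (k : fieldType) H of GRing.Algebra k H := {
  comul : H -> seq (H * H);
  counit : H -> k;
  antipode : H -> H;
  comul_linear : forall F : H -> H -> k, biscalar_map F ->
    scalar (fun a => \sw_(a1, a2 <- comul a) F a1 a2);
  counit_linear : scalar counit;
  antipode_linear : linear antipode;
  coassoc : forall F : H -> H -> H -> k, triscalar_map F -> forall a,
    \sw_(a1, a2 <- comul a) \sw_(a11, a12 <- comul a1) F a11 a12 a2 =
    \sw_(a1, a2 <- comul a) \sw_(a21, a22 <- comul a2) F a1 a21 a22;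
  counitl : forall a, \sw_(a1, a2 <- comul a) (counit a1 *: a2) = a;
  counitr : forall a, \sw_(a1, a2 <- comul a) (counit a2 *: a1) = a;
  comul1 : forall F : H -> H -> k, biscalar_map F ->
    \sw_(a1, a2 <- comul 1) F a1 a2 = F 1 1;
  comulM : forall F : H -> H -> k, biscalar_map F -> forall a b,
    \sw_(c1, c2 <- comul (a * b)) F c1 c2 =
    \sw_(a1, a2 <- comul a) \sw_(b1, b2 <- comul b) F (a1 * b1) (a2 * b2);
  counit_monoid : monoid_morphism counit;
  antipodel : forall a, \sw_(a1, a2 <- comul a) (antipode a1 * a2) =
    counit a *: 1;
  antipoder : forall a, \sw_(a1, a2 <- comul a) (a1 * antipode a2) =
    counit a *: 1
}.

#[short(type="hopfType")]
HB.structure Definition Hopf (k : fieldType) :=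
  { H of GRing.Algebra k H & isHopf k H }.

Notation "'Delta' a" := (comul a) (at level 10, a at level 8) : ring_scope.

Section Cochains.
Variables (k : fieldType) (H : hopfType k).

(* A convolution inverse is unique, so bundling it adds no data. *)
Record reg1 := Reg1 {
  reg1_fun :> {scalar H};
  reg1_inv : {scalar H};
  reg1_unit : reg1_fun 1 = 1;
  reg1_mulV : forall h,
    \sw_(h1, h2 <- Delta h) (reg1_fun h1 * reg1_inv h2) = counit h;
  reg1_Vmul : forall h,
    \sw_(h1, h2 <- Delta h) (reg1_inv h1 * reg1_fun h2) = counit h
}.

Record reg2 := Reg2 {
  reg2_fun :> {biscalar H};
  reg2_inv : {biscalar H};
  reg2_unitl : forall h, reg2_fun 1 h = counit h;
  reg2_unitr : forall h, reg2_fun h 1 = counit h;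
  reg2_mulV : forall a b,
    \sw_(a1, a2 <- Delta a) \sw_(b1, b2 <- Delta b)
      (reg2_fun a1 b1 * reg2_inv a2 b2) = counit a * counit b;
  reg2_Vmul : forall a b,
    \sw_(a1, a2 <- Delta a) \sw_(b1, b2 <- Delta b)
      (reg2_inv a1 b1 * reg2_fun a2 b2) = counit a * counit b
}.

Definition is_cocycle (sigma : reg2) := forall a b c,
  \sw_(a1, a2 <- Delta a) \sw_(b1, b2 <- Delta b)
    (sigma a1 b1 * sigma (a2 * b2) c) =
  \sw_(b1, b2 <- Delta b) \sw_(c1, c2 <- Delta c)
    (sigma b1 c1 * sigma a (b2 * c2)).

Definition lazy1 (eta : reg1) := forall h,
  \sw_(h1, h2 <- Delta h) (eta h1 *: h2) =
  \sw_(h1, h2 <- Delta h) (eta h2 *: h1).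

Definition lazy2 (sigma : reg2) := forall a b,
  \sw_(a1, a2 <- Delta a) \sw_(b1, b2 <- Delta b)
    (sigma a1 b1 *: (a2 * b2)) =
  \sw_(a1, a2 <- Delta a) \sw_(b1, b2 <- Delta b)
    (sigma a2 b2 *: (a1 * b1)).

Definition lazy_cocycle (sigma : reg2) := is_cocycle sigma /\ lazy2 sigma.

Definition coboundary (eta : reg1) (a b : H) : k :=
  \sw_(a1, a2 <- Delta a) \sw_(b1, b2 <- Delta b)
    (eta a1 * eta b1 * reg1_inv eta (a2 * b2)).

Definition trivial_H2 (s : H -> H -> k) :=
  exists mu : reg1, forall a b, s a b = coboundary mu a b.

Definition trivial_lazy_H2 (s : H -> H -> k) :=
  exists2 mu : reg1, lazy1 mu & forall a b, s a b = coboundary mu a b.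

End Cochains.

Definition trivial_group_H2 (k : fieldType) (G : finGroupType)
    (b : G -> G -> k) :=
  exists2 eta : G -> k, forall g, eta g != 0 &
    forall g h, b g h = eta g * eta h / eta (g * h)%g.

Section SumFacts.
Variables (k : fieldType) (T : finType).

Lemma sum_delta (h : T -> k) (j : T) : \sum_i (i == j)%:R * h i = h j.
Proof.
rewrite (bigD1 j) //= eqxx mul1r big1 ?addr0 // => i /negPf->.
by rewrite mul0r.
Qed.

Lemma sum_delta_sym (h : T -> k) (j : T) : \sum_i (j == i)%:R * h i = h j.
Proof. by rewrite -[RHS]sum_delta; apply: eq_bigr => i _; rewrite eq_sym. Qed.

Lemma scalar_fZ (U : lmodType k) (f : U -> k) : scalar f ->
  forall c u, f (c *: u) = c * f u.
Proof.
move=> f_lin c u; have f0 : f 0 = 0.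
  have := f_lin 1 0 0; rewrite scale1r addr0 mul1r => /esym/eqP.
  by rewrite -subr_eq0 addrK => /eqP.
by rewrite -[c *: u]addr0 f_lin f0 addr0.
Qed.

Lemma scalar_f0 (U : lmodType k) (f : U -> k) : scalar f -> f 0 = 0.
Proof. by move=> f_lin; rewrite -(scale0r 0) scalar_fZ // mul0r. Qed.

Lemma scalar_fsum (U : lmodType k) (f : U -> k) (c : T -> U) : scalar f ->
  f (\sum_i c i) = \sum_i f (c i).
Proof.
move=> f_lin; apply: (big_morph f) => [u v|]; last exact: scalar_f0.
by rewrite -[u]scale1r f_lin mul1r scale1r.
Qed.

Lemma sum_deltaZ (U : lmodType k) (h : T -> U) (j : T) :
  \sum_i (i == j)%:R *: h i = h j.
Proof.
rewrite (bigD1 j) //= eqxx scale1r big1 ?addr0 // => i /negPf->.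
by rewrite scale0r.
Qed.

End SumFacts.

Section FunAlgebra.
Variables (k : fieldType) (G : finGroupType).

Definition funalg := {ffun G -> k}.

HB.instance Definition _ := GRing.Zmodule.copy funalg {ffun G -> k}.

Fact funalg_nonzero : ssralg.ffun_one G k != 0.
Proof. exact: ssralg.ffun1_nonzero 1%g. Qed.

HB.instance Definition _ := GRing.Zmodule_isNzRing.Build funalg
  (@ssralg.ffun_mulA _ _) (@ssralg.ffun_mul_1l _ _) (@ssralg.ffun_mul_1r _ _)
  (@ssralg.ffun_mul_addl _ _) (@ssralg.ffun_mul_addr _ _) funalg_nonzero.

HB.instance Definition _ := GRing.Zmodule_isLmodule.Build k funalg
  (@ssralg.ffun_scaleA _ _ k^o) (@ssralg.ffun_scale1 _ _ k^o)
  (@ssralg.ffun_scale_addr _ _ k^o) (@ssralg.ffun_scale_addl _ _ k^o).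

Fact funalg_scalerAl (c : k) (u v : funalg) : c *: (u * v) = c *: u * v.
Proof. by apply/ffunP=> x; rewrite !ffunE; apply: mulrA. Qed.
HB.instance Definition _ :=
  GRing.Lmodule_isLalgebra.Build k funalg funalg_scalerAl.

Fact funalg_scalerAr (c : k) (u v : funalg) : c *: (u * v) = u * (c *: v).
Proof. by apply/ffunP=> x; rewrite !ffunE; apply: mulrCA. Qed.
HB.instance Definition _ :=
  GRing.Lalgebra_isAlgebra.Build k funalg funalg_scalerAr.

Definition dlt (x : G) : funalg := [ffun y => (x == y)%:R].

Definition funalg_comul (f : funalg) : seq (funalg * funalg) :=
  [seq (f (p.1 * p.2)%g *: dlt p.1, dlt p.2) | p : G * G].
Definition funalg_counit (f : funalg) : k := f 1%g.
Definition funalg_antipode (f : funalg) : funalg := [ffun x => f x^-1%g].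

Lemma funalg_sum (f : funalg) : f = \sum_x f x *: dlt x.
Proof.
apply/ffunP=> y; rewrite sum_ffunE (bigD1 y) //= big1 ?addr0 => [|x xy].
  by rewrite !ffunE eqxx /GRing.scale /= mulr1.
by rewrite !ffunE (negPf xy) /GRing.scale /= mulr0.
Qed.

Lemma funalg_sw (V : nmodType) (F : funalg -> funalg -> V) (f : funalg) :
  \sw_(f1, f2 <- funalg_comul f) F f1 f2 =
  \sum_(p : G * G) F (f (p.1 * p.2)%g *: dlt p.1) (dlt p.2).
Proof. by rewrite /sweedler big_map big_enum. Qed.

Lemma funalg_swE (F : funalg -> funalg -> k) (f : funalg) : biscalar_map F ->
  \sw_(f1, f2 <- funalg_comul f) F f1 f2 =
  \sum_x \sum_y f (x * y)%g * F (dlt x) (dlt y).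
Proof.
case=> Fl _; rewrite funalg_sw pair_bigA /=.
by apply: eq_bigr => p _; apply: (scalar_fZ (Fl _)).
Qed.

Fact funalg_comul_linear (F : funalg -> funalg -> k) : biscalar_map F ->
  scalar (fun f => \sw_(f1, f2 <- funalg_comul f) F f1 f2).
Proof.
move=> F2 c f g; rewrite !funalg_swE // mulr_sumr -big_split /=.
apply: eq_bigr => x _; rewrite mulr_sumr -big_split /=.
by apply: eq_bigr => y _; rewrite !ffunE mulrDl mulrA.
Qed.

Fact funalg_coassoc (F : funalg -> funalg -> funalg -> k) : triscalar_map F ->
  forall f,
  \sw_(f1, f2 <- funalg_comul f) \sw_(f11, f12 <- funalg_comul f1)
    F f11 f12 f2 =
  \sw_(f1, f2 <- funalg_comul f) \sw_(f21, f22 <- funalg_comul f2)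
    F f1 f21 f22.
Proof.
case=> F1 F2 F3 f.
pose S := \sum_x \sum_y \sum_z
  f (x * y * z)%g * F (dlt x) (dlt y) (dlt z).
transitivity S.
  rewrite funalg_sw; under eq_bigr => p _.
    rewrite funalg_swE; last by split.
    over.
  rewrite -(pair_bigA _ (fun t z => \sum_x \sum_y
    (f (t * z)%g *: dlt t) (x * y)%g * F (dlt x) (dlt y) (dlt z))) /=.
  under eq_bigr => t _ do (rewrite exchange_big; under eq_bigr => x _ do
    rewrite exchange_big).
  rewrite exchange_big; apply: eq_bigr => x _.
  rewrite exchange_big; apply: eq_bigr => y _.
  rewrite exchange_big; apply: eq_bigr => z _.
  rewrite -(sum_delta (fun t => f (t * z)%g * F (dlt x) (dlt y) (dlt z))).
  by apply: eq_bigr => t _; rewrite !ffunE /GRing.scale /= mulrA [_ * f _]mulrC.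
rewrite funalg_sw; under eq_bigr => p _.
  rewrite funalg_swE; last by split.
  over.
rewrite -(pair_bigA _ (fun x t => \sum_y \sum_z
  dlt t (y * z)%g * F (f (x * t)%g *: dlt x) (dlt y) (dlt z))) /=.
apply: eq_bigr => x _; rewrite [RHS]exchange_big; apply: eq_bigr => y _.
rewrite [RHS]exchange_big; apply: eq_bigr => z _; rewrite -mulgA.
rewrite -(sum_delta (fun t => f (x * t)%g * F (dlt x) (dlt y) (dlt z))).
apply: eq_bigr => t _; rewrite !ffunE.
by congr (_ * _); apply/esym/(scalar_fZ (F1 (dlt y) (dlt z))).
Qed.

Fact funalg_counitl (f : funalg) :
  \sw_(f1, f2 <- funalg_comul f) (funalg_counit f1 *: f2) = f.
Proof.
rewrite funalg_sw [RHS]funalg_sum.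
rewrite -(pair_bigA _ (fun x y =>
  funalg_counit (f (x * y)%g *: dlt x) *: dlt y)) /=.
rewrite exchange_big; apply: eq_bigr => y _; rewrite -scaler_suml.
congr (_ *: _).
rewrite -[in RHS](mul1g y) -(sum_delta (fun x => f (x * y)%g)).
by apply: eq_bigr => x _; rewrite /funalg_counit !ffunE mulrC.
Qed.

Fact funalg_counitr (f : funalg) :
  \sw_(f1, f2 <- funalg_comul f) (funalg_counit f2 *: f1) = f.
Proof.
rewrite funalg_sw [RHS]funalg_sum.
rewrite -(pair_bigA _ (fun x y =>
  funalg_counit (dlt y) *: (f (x * y)%g *: dlt x))) /=.
apply: eq_bigr => x _; under eq_bigr => y _ do rewrite scalerA.
rewrite -scaler_suml; congr (_ *: _).
rewrite -[in RHS](mulg1 x) -(sum_delta (fun y => f (x * y)%g)).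
by apply: eq_bigr => y _; rewrite /funalg_counit !ffunE.
Qed.

Fact funalg_comulM (F : funalg -> funalg -> k) : biscalar_map F ->
  forall f g,
  \sw_(h1, h2 <- funalg_comul (f * g)) F h1 h2 =
  \sw_(f1, f2 <- funalg_comul f) \sw_(g1, g2 <- funalg_comul g)
    F (f1 * g1) (f2 * g2).
Proof.
move=> [Fl Fr] f g; rewrite funalg_swE // funalg_sw.
rewrite pair_bigA; apply: eq_bigr => -[x y] _ /=; rewrite funalg_sw.
rewrite (bigD1 (x, y)) //= big1 ?addr0.
  have dd z : dlt z * dlt z = dlt z.
    by apply/ffunP=> t; rewrite !ffunE -natrM mulnb andbb.
  rewrite -scalerAl -scalerAr !dd scalerA.
  by rewrite [RHS](scalar_fZ (Fl _)) ffunE.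
have d0 z t : z != t -> dlt z * dlt t = 0.
  move=> ztN; apply/ffunP=> u; rewrite !ffunE -natrM mulnb.
  by case: eqP => // <-; rewrite eq_sym (negPf ztN).
case=> z t; rewrite xpair_eqE negb_and /= => /orP[zN|tN].
  rewrite -scalerAl -scalerAr (d0 x z) 1?eq_sym // !scaler0.
  exact: (scalar_f0 (Fl _)).
rewrite (d0 y t) 1?eq_sym //; exact: (scalar_f0 (Fr _)).
Qed.

Fact funalg_comul1 (F : funalg -> funalg -> k) : biscalar_map F ->
  \sw_(f1, f2 <- funalg_comul 1) F f1 f2 = F 1 1.
Proof.
move=> FB; have [Fl Fr] := FB; rewrite funalg_swE //.
have one_sum : 1 = \sum_x dlt x.
  by rewrite [LHS]funalg_sum; apply: eq_bigr => x _; rewrite ffunE scale1r.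
rewrite [X in F X]one_sum [RHS](scalar_fsum dlt (Fl _)).
apply: eq_bigr => x _; rewrite one_sum [RHS](scalar_fsum dlt (Fr _)).
by apply: eq_bigr => y _; rewrite -one_sum ffunE mul1r.
Qed.

Fact funalg_counit_linear : scalar funalg_counit.
Proof. by move=> c f g; rewrite /funalg_counit !ffunE. Qed.

Fact funalg_counit_monoid : monoid_morphism funalg_counit.
Proof. by split=> [|f g]; rewrite /funalg_counit !ffunE. Qed.

Fact funalg_antipode_linear : linear funalg_antipode.
Proof. by move=> c f g; apply/ffunP=> x; rewrite !ffunE. Qed.

Fact funalg_antipodel (f : funalg) :
  \sw_(f1, f2 <- funalg_comul f) (funalg_antipode f1 * f2) =
  funalg_counit f *: 1.
Proof.
rewrite funalg_sw; apply/ffunP=> z; rewrite sum_ffunE !ffunE.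
rewrite -(pair_bigA _ (fun x y =>
  (funalg_antipode (f (x * y)%g *: dlt x) * dlt y) z)) /=.
rewrite exchange_big (bigD1 z) //= [X in _ + X]big1 ?addr0 => [|y yN].
  rewrite (bigD1 z^-1%g) //= big1 ?addr0 => [|x xN]; last first.
    by rewrite !ffunE (negPf xN) [_ *: _]mulr0 mul0r.
  by rewrite !ffunE !eqxx mulVg [X in X * _]mulr1 mulr1 [RHS]mulr1.
by rewrite big1 // => x _; rewrite !ffunE (negPf yN) mulr0.
Qed.

Fact funalg_antipoder (f : funalg) :
  \sw_(f1, f2 <- funalg_comul f) (f1 * funalg_antipode f2) =
  funalg_counit f *: 1.
Proof.
rewrite funalg_sw; apply/ffunP=> z; rewrite sum_ffunE !ffunE.
rewrite -(pair_bigA _ (fun x y =>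
  ((f (x * y)%g *: dlt x) * funalg_antipode (dlt y)) z)) /=.
rewrite (bigD1 z) //= [X in _ + X]big1 ?addr0 => [|x xN].
  rewrite (bigD1 z^-1%g) //= big1 ?addr0 => [|y yN]; last first.
    by rewrite !ffunE (negPf yN) mulr0.
  by rewrite !ffunE !eqxx mulgV mulr1.
by rewrite big1 // => y _; rewrite !ffunE (negPf xN) [_ *: _]mulr0 mul0r.
Qed.

HB.instance Definition _ := isHopf.Build k funalg
  funalg_comul_linear funalg_counit_linear funalg_antipode_linear
  funalg_coassoc funalg_counitl funalg_counitr funalg_comul1 funalg_comulM
  funalg_counit_monoid funalg_antipodel funalg_antipoder.

End FunAlgebra.

Section DoubleDual.
Variables (k : fieldType) (G : finGroupType).
Local Notation kG := (funalg k G).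

(* The value of a : DGdual at (x, y) is the coefficient of x \times e_y. *)
Definition DGdual := {ffun G * G -> k}.

HB.instance Definition _ := GRing.Zmodule.copy DGdual {ffun G * G -> k}.

HB.instance Definition _ := GRing.Zmodule_isLmodule.Build k DGdual
  (@ssralg.ffun_scaleA _ _ k^o) (@ssralg.ffun_scale1 _ _ k^o)
  (@ssralg.ffun_scale_addr _ _ k^o) (@ssralg.ffun_scale_addl _ _ k^o).

(* The element x \times f. *)
Definition cross (x : G) (f : kG) : DGdual :=
  [ffun p => (x == p.1)%:R * f p.2].

Definition DGdual_one : DGdual := cross 1%g 1.
Definition DGdual_mul (a b : DGdual) : DGdual :=
  [ffun p => \sum_(u : G) a (u, p.2) * b ((u^-1 * p.1)%g, p.2)].

Fact DGdual_mulA : associative DGdual_mul.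
Proof.
move=> a b c; apply/ffunP=> -[x y]; rewrite !ffunE /=.
under eq_bigr => u _ do rewrite ffunE mulr_sumr /=.
under [RHS]eq_bigr => v _ do rewrite ffunE mulr_suml /=.
rewrite [RHS]exchange_big /=; apply: eq_bigr => u _.
rewrite [RHS](reindex_inj (mulgI u)) /=; apply: eq_bigr => v _.
by rewrite mulKg invMg mulrA mulgA.
Qed.

Fact DGdual_mul1l : left_id DGdual_one DGdual_mul.
Proof.
move=> a; apply/ffunP=> -[x y]; rewrite !ffunE /=.
under eq_bigr => u _ do rewrite !ffunE /= mulr1.
by rewrite (sum_delta_sym (fun u => a ((u^-1 * x)%g, y))) invg1 mul1g.
Qed.

Fact DGdual_mul1r : right_id DGdual_one DGdual_mul.
Proof.
move=> a; apply/ffunP=> -[x y]; rewrite !ffunE /=.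
under eq_bigr => u _.
  rewrite !ffunE /= mulr1 mulrC eq_sym -eq_mulVg1.
  over.
exact: (sum_delta (fun u => a (u, y))).
Qed.

Fact DGdual_mulDl : left_distributive DGdual_mul +%R.
Proof.
move=> a b c; apply/ffunP=> p; rewrite !ffunE -big_split /=.
by apply: eq_bigr => u _; rewrite ffunE mulrDl.
Qed.

Fact DGdual_mulDr : right_distributive DGdual_mul +%R.
Proof.
move=> a b c; apply/ffunP=> p; rewrite !ffunE -big_split /=.
by apply: eq_bigr => u _; rewrite ffunE mulrDr.
Qed.

Fact DGdual_one_neq0 : DGdual_one != 0.
Proof.
apply/eqP=> /ffunP/(_ (1%g, 1%g))/eqP.
by rewrite !ffunE eqxx mulr1 oner_eq0.
Qed.

HB.instance Definition _ := GRing.Zmodule_isNzRing.Build DGdual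
  DGdual_mulA DGdual_mul1l DGdual_mul1r DGdual_mulDl DGdual_mulDr
  DGdual_one_neq0.

Fact DGdual_scalerAl (c : k) (a b : DGdual) : c *: (a * b) = c *: a * b.
Proof.
apply/ffunP=> p; rewrite !ffunE scaler_sumr.
by apply: eq_bigr => u _; rewrite !ffunE; apply: mulrA.
Qed.
HB.instance Definition _ :=
  GRing.Lmodule_isLalgebra.Build k DGdual DGdual_scalerAl.

Fact DGdual_scalerAr (c : k) (a b : DGdual) : c *: (a * b) = a * (c *: b).
Proof.
apply/ffunP=> p; rewrite !ffunE scaler_sumr.
by apply: eq_bigr => u _; rewrite !ffunE; apply: mulrCA.
Qed.
HB.instance Definition _ :=
  GRing.Lalgebra_isAlgebra.Build k DGdual DGdual_scalerAr.

Lemma crossM x x' (f f' : kG) :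
  cross x f * cross x' f' = cross (x * x')%g (f * f').
Proof.
apply/ffunP=> -[u v]; rewrite !ffunE /=.
under eq_bigr => w _ do rewrite !ffunE /= -mulrA.
rewrite (sum_delta_sym (fun w => f v * ((x' == (w^-1 * u)%g)%:R * f' v))).
by rewrite mulrCA (can2_eq (mulKg x) (mulKVg x)).
Qed.

Lemma DGdual_sum (a : DGdual) :
  a = \sum_x \sum_y a (x, y) *: cross x (dlt k y).
Proof.
apply/ffunP=> -[x y]; rewrite pair_bigA sum_ffunE (bigD1 (x, y)) //=.
rewrite big1 ?addr0 => [|[u v]].
  by rewrite !ffunE !eqxx /GRing.scale /= !mulr1.
rewrite xpair_eqE negb_and !ffunE /= => /orP[/negPf-> | /negPf->].
  by rewrite mul0r; apply: mulr0.
by rewrite mulr0; apply: mulr0.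
Qed.

(* Here p = (x, (y1, y2)); in MathComp x ^ y = y^-1 * x * y. *)
Definition DGdual_comul (a : DGdual) : seq (DGdual * DGdual) :=
  [seq (a (p.1, p.2.1 * p.2.2)%g *: cross p.1 (dlt k p.2.1),
        cross (p.1 ^ p.2.1)%g (dlt k p.2.2)) | p : G * (G * G)].
Definition DGdual_counit (a : DGdual) : k := \sum_x a (x, 1%g).
(* S(x \times e_y) = y^-1 * x^-1 * y \times e_(y^-1). *)
Definition DGdual_antipode (a : DGdual) : DGdual :=
  [ffun p => a ((p.1 ^ p.2)^-1, p.2^-1)%g].

Lemma DGdual_sw (V : nmodType) (F : DGdual -> DGdual -> V) (a : DGdual) :
  \sw_(a1, a2 <- DGdual_comul a) F a1 a2 =
  \sum_x \sum_y1 \sum_y2 F (a (x, y1 * y2)%g *: cross x (dlt k y1))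
                           (cross (x ^ y1)%g (dlt k y2)).
Proof.
rewrite /sweedler big_map big_enum /=.
under [RHS]eq_bigr => x _ do rewrite pair_bigA.
by rewrite pair_bigA.
Qed.

Lemma DGdual_swE (F : DGdual -> DGdual -> k) (a : DGdual) : biscalar_map F ->
  \sw_(a1, a2 <- DGdual_comul a) F a1 a2 =
  \sum_x \sum_y1 \sum_y2 a (x, y1 * y2)%g *
     F (cross x (dlt k y1)) (cross (x ^ y1)%g (dlt k y2)).
Proof.
case=> Fl _; rewrite DGdual_sw; apply: eq_bigr => x _.
apply: eq_bigr => y1 _; apply: eq_bigr => y2 _; exact: (scalar_fZ (Fl _)).
Qed.

Lemma DGdual_sw_cross (F : DGdual -> DGdual -> k) x (f : kG) :
  biscalar_map F ->
  \sw_(a1, a2 <- DGdual_comul (cross x f)) F a1 a2 =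
  \sum_y1 \sum_y2 f (y1 * y2)%g *
     F (cross x (dlt k y1)) (cross (x ^ y1)%g (dlt k y2)).
Proof.
move=> FB; rewrite DGdual_swE // -[RHS](sum_delta_sym (fun u =>
 \sum_y1 \sum_y2 f (y1 * y2)%g * F (cross u (dlt k y1)) (cross _ (dlt k y2)))).
apply: eq_bigr => u _; rewrite mulr_sumr; apply: eq_bigr => y1 _.
by rewrite mulr_sumr; apply: eq_bigr => y2 _; rewrite ffunE mulrA.
Qed.

Fact DGdual_comul_linear (F : DGdual -> DGdual -> k) : biscalar_map F ->
  scalar (fun a => \sw_(a1, a2 <- DGdual_comul a) F a1 a2).
Proof.
move=> F2 c a b; rewrite !DGdual_swE //.
do 3!(rewrite mulr_sumr -big_split /=; apply: eq_bigr => ? _).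
by rewrite !ffunE mulrDl mulrA.
Qed.

Fact DGdual_counit_linear : scalar DGdual_counit.
Proof.
move=> c a b; rewrite /DGdual_counit mulr_sumr -big_split /=.
by apply: eq_bigr => x _; rewrite !ffunE.
Qed.

Fact DGdual_antipode_linear : linear DGdual_antipode.
Proof. by move=> c a b; apply/ffunP=> x; rewrite !ffunE. Qed.

Fact DGdual_counit_monoid : monoid_morphism DGdual_counit.
Proof.
split=> [|a b]; rewrite /DGdual_counit.
  under eq_bigr => x _ do rewrite ffunE /= ffunE.
  exact: (sum_delta_sym (fun=> 1)).
under eq_bigr => x _ do rewrite ffunE /=.
rewrite exchange_big mulr_suml; apply: eq_bigr => u _ /=.
rewrite -mulr_sumr; congr (_ * _).
by rewrite [RHS](reindex_inj (mulgI u^-1%g)).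
Qed.

Lemma DGdual_sw_dlt (F : DGdual -> DGdual -> k) x y : biscalar_map F ->
  \sw_(a1, a2 <- DGdual_comul (cross x (dlt k y))) F a1 a2 =
  \sum_y1 F (cross x (dlt k y1)) (cross (x ^ y1)%g (dlt k (y1^-1 * y)%g)).
Proof.
move=> FB; rewrite DGdual_sw_cross //; apply: eq_bigr => y1 _.
rewrite -[RHS](sum_delta_sym (fun y2 => F _ (cross _ (dlt k y2)))).
apply: eq_bigr => y2 _; rewrite ffunE.
by rewrite -(can2_eq (mulKVg y1) (mulKg y1)).
Qed.

Lemma crossZ x c (f : kG) : cross x (c *: f) = c *: cross x f.
Proof. by apply/ffunP=> p; rewrite !ffunE; apply: mulrCA. Qed.

Lemma dltM (y z : G) : dlt k y * dlt k z = (y == z)%:R *: dlt k z.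
Proof.
apply/ffunP=> t; rewrite !ffunE /GRing.scale /=.
by case: (eqVneq z t) => [->|_]; rewrite ?mulr0 ?mulr1.
Qed.

Lemma cross1 : 1 = \sum_y cross 1%g (dlt k y) :> DGdual.
Proof.
rewrite [LHS]DGdual_sum exchange_big; apply: eq_bigr => y _ /=.
rewrite -[RHS](sum_deltaZ (fun x => cross x (dlt k y))).
by apply: eq_bigr => x _; rewrite !ffunE mulr1 eq_sym.
Qed.

Lemma DGdual_antipode_cross x y : DGdual_antipode (cross x (dlt k y)) =
  cross (x ^ y)^-1%g (dlt k y^-1%g).
Proof.
apply/ffunP=> -[u v]; rewrite !ffunE /=.
have invE s t : (s^-1 == t)%g = (s == t^-1)%g.
  by apply/eqP/eqP => [<-|->]; rewrite invgK.
rewrite invE [in RHS]invE; case: (eqVneq y _) => [->|_]; rewrite ?mulr0 //.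
by rewrite !mulr1 -conjVg (canF_eq (conjgKV v)).
Qed.

Fact DGdual_coassoc (F : DGdual -> DGdual -> DGdual -> k) : triscalar_map F ->
  forall a,
  \sw_(a1, a2 <- DGdual_comul a) \sw_(a11, a12 <- DGdual_comul a1)
    F a11 a12 a2 =
  \sw_(a1, a2 <- DGdual_comul a) \sw_(a21, a22 <- DGdual_comul a2)
    F a1 a21 a22.
Proof.
case=> F1 F2 F3 a.
pose S := \sum_x \sum_y1 \sum_y2 \sum_y3
  a (x, y1 * y2 * y3)%g * F (cross x (dlt k y1)) (cross (x ^ y1)%g (dlt k y2))
  (cross (x ^ (y1 * y2))%g (dlt k y3)).
transitivity S.
  rewrite DGdual_sw; apply: eq_bigr => x _.
  transitivity (\sum_t \sum_z \sum_y1 \sum_y2 (t == y1 * y2)%g%:R *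
    (a (x, t * z)%g *
      F (cross x (dlt k y1)) (cross (x ^ y1)%g (dlt k y2))
        (cross (x ^ t)%g (dlt k z)))).
    apply: eq_bigr => t _; apply: eq_bigr => z _.
    have FB : biscalar_map (fun u v => F u v (cross (x ^ t)%g (dlt k z))).
      by split.
    rewrite [LHS](scalar_fZ (DGdual_comul_linear FB)) DGdual_sw_cross //.
    rewrite mulr_sumr; apply: eq_bigr => y1 _.
    rewrite mulr_sumr; apply: eq_bigr => y2 _.
    by rewrite ffunE mulrCA.
  under eq_bigr => t _ do (rewrite exchange_big; under eq_bigr => y1 _ do
    rewrite exchange_big).
  rewrite exchange_big; apply: eq_bigr => y1 _.
  rewrite exchange_big; apply: eq_bigr => y2 _.
  rewrite exchange_big; apply: eq_bigr => z _.
  exact: (sum_delta (fun t => a (x, t * z)%g * F _ _ (cross (x ^ t)%g _))).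
rewrite DGdual_sw; apply: eq_bigr => x _; apply: eq_bigr => y1 _.
transitivity (\sum_t \sum_y2 \sum_y3 (t == y2 * y3)%g%:R *
    (a (x, y1 * t)%g * F (cross x (dlt k y1)) (cross (x ^ y1)%g (dlt k y2))
        (cross (x ^ (y1 * y2))%g (dlt k y3)))).
  rewrite [RHS]exchange_big; under [RHS]eq_bigr => y2 _ do
    rewrite exchange_big.
  apply: eq_bigr => y2 _; apply: eq_bigr => y3 _.
  rewrite (sum_delta (fun t => a (x, y1 * t)%g * F _ _ _)).
  by rewrite mulgA.
apply: eq_bigr => t _.
have FB : biscalar_map (F (a (x, y1 * t)%g *: cross x (dlt k y1))).
  by split.
rewrite DGdual_sw_cross //.
apply: eq_bigr => y2 _; apply: eq_bigr => y3 _.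
by rewrite ffunE [F (_ *: _) _ _](scalar_fZ (F1 _ _)) conjgM.
Qed.

Lemma DGdual_counit_cross x (f : kG) : DGdual_counit (cross x f) = f 1%g.
Proof.
rewrite /DGdual_counit -[RHS](sum_delta_sym (fun=> f 1%g) x).
by apply: eq_bigr => u _; rewrite ffunE.
Qed.

Fact DGdual_counitl (a : DGdual) :
  \sw_(a1, a2 <- DGdual_comul a) (DGdual_counit a1 *: a2) = a.
Proof.
rewrite DGdual_sw [RHS]DGdual_sum; apply: eq_bigr => x _.
rewrite exchange_big; apply: eq_bigr => y _ /=.
transitivity (\sum_u (u == 1%g)%:R *: (a (x, u * y)%g *:
  cross (x ^ u)%g (dlt k y))); last by rewrite sum_deltaZ mul1g conjg1.
apply: eq_bigr => u _; rewrite (scalar_fZ DGdual_counit_linear).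
by rewrite DGdual_counit_cross ffunE scalerA mulrC.
Qed.

Fact DGdual_counitr (a : DGdual) :
  \sw_(a1, a2 <- DGdual_comul a) (DGdual_counit a2 *: a1) = a.
Proof.
rewrite DGdual_sw [RHS]DGdual_sum; apply: eq_bigr => x _.
apply: eq_bigr => y _ /=.
transitivity (\sum_u (u == 1%g)%:R *: (a (x, y * u)%g *: cross x (dlt k y))).
  by apply: eq_bigr => u _; rewrite DGdual_counit_cross ffunE.
by rewrite sum_deltaZ mulg1.
Qed.

Fact DGdual_comul1 (F : DGdual -> DGdual -> k) : biscalar_map F ->
  \sw_(a1, a2 <- DGdual_comul 1) F a1 a2 = F 1 1.
Proof.
move=> FB; have [Fl Fr] := FB; rewrite DGdual_sw_cross // cross1.
rewrite [RHS](scalar_fsum _ (Fl _)).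
apply: eq_bigr => x _; rewrite [RHS](scalar_fsum _ (Fr _)).
by apply: eq_bigr => y _; rewrite ffunE mul1r conj1g.
Qed.

Fact DGdual_comulM (F : DGdual -> DGdual -> k) : biscalar_map F ->
  forall a b,
  \sw_(c1, c2 <- DGdual_comul (a * b)) F c1 c2 =
  \sw_(a1, a2 <- DGdual_comul a) \sw_(b1, b2 <- DGdual_comul b)
    F (a1 * b1) (a2 * b2).
Proof.
move=> FB a b; have [Fl Fr] := FB.
pose S := \sum_u \sum_v \sum_y1 \sum_y2
  a (u, y1 * y2)%g * b (v, y1 * y2)%g *
  F (cross (u * v)%g (dlt k y1)) (cross ((u * v) ^ y1)%g (dlt k y2)).
transitivity S.
  rewrite DGdual_swE //.
  under eq_bigr => x _ do (under eq_bigr => y1 _ do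
    (under eq_bigr => y2 _ do rewrite ffunE mulr_suml /=;
     rewrite exchange_big); rewrite exchange_big).
  rewrite exchange_big; apply: eq_bigr => u _.
  rewrite (reindex_inj (mulgI u)); apply: eq_bigr => v _ /=.
  by apply: eq_bigr => y1 _; apply: eq_bigr => y2 _; rewrite mulKg.
rewrite DGdual_sw; apply: eq_bigr => u _.
rewrite exchange_big; apply: eq_bigr => y1 _.
rewrite exchange_big; apply: eq_bigr => y2 _.
set c := a _; rewrite DGdual_swE; last first.
  split=> w c' b1 b2 /=.
    by rewrite mulrDr -scalerAr; apply: (Fl _).
  by rewrite mulrDr -scalerAr; apply: (Fr _).
apply: eq_bigr => v _.
rewrite (bigD1 y1) //= [X in _ + X]big1 ?addr0 => [|z1 z1N]; last first.
  apply: big1 => z2 _.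
  rewrite -scalerAl (crossM u) (dltM y1) [y1 == _]eq_sym (negPf z1N) scale0r.
  rewrite -[0 : kG](scale0r 0) crossZ scale0r scaler0.
  by rewrite [F _ _](scalar_f0 (Fl _)) mulr0.
rewrite (bigD1 y2) //= [X in _ + X]big1 ?addr0 => [|z2 z2N]; last first.
  rewrite !crossM (dltM y2) [y2 == _]eq_sym (negPf z2N) scale0r.
  rewrite -[0 : kG](scale0r 0) crossZ scale0r.
  by rewrite [F _ _](scalar_f0 (Fr _)) mulr0.
rewrite -scalerAl !crossM !dltM !eqxx !scale1r -conjMg.
by rewrite [F (_ *: _) _](scalar_fZ (Fl _)) mulrCA mulrA.
Qed.

Fact DGdual_antipodel (a : DGdual) :
  \sw_(a1, a2 <- DGdual_comul a) (DGdual_antipode a1 * a2) =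
  DGdual_counit a *: 1.
Proof.
rewrite DGdual_sw scaler_suml; apply: eq_bigr => x _.
rewrite exchange_big cross1 scaler_sumr; apply: eq_bigr => y _ /=.
transitivity (\sum_t (t == y^-1)%g%:R *:
  (a (x, t * y)%g *: cross 1%g (dlt k y))); last by rewrite sum_deltaZ mulVg.
apply: eq_bigr => t _.
have SZ c b : DGdual_antipode (c *: b) = c *: DGdual_antipode b.
  by apply/ffunP=> p; rewrite !ffunE.
rewrite SZ -scalerAl DGdual_antipode_cross crossM dltM mulVg crossZ.
by rewrite scalerA mulrC scalerA (inv_eq invgK).
Qed.

Fact DGdual_antipoder (a : DGdual) :
  \sw_(a1, a2 <- DGdual_comul a) (a1 * DGdual_antipode a2) =
  DGdual_counit a *: 1.
Proof.
rewrite DGdual_sw scaler_suml; apply: eq_bigr => x _.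
rewrite cross1 scaler_sumr; apply: eq_bigr => y _ /=.
transitivity (\sum_t (t == y^-1)%g%:R *:
  (a (x, y * t)%g *: cross 1%g (dlt k y))); last by rewrite sum_deltaZ mulgV.
apply: eq_bigr => t _.
rewrite -scalerAl DGdual_antipode_cross crossM dltM crossZ.
rewrite scalerA mulrC -scalerA [y == _]eq_sym (inv_eq invgK).
case: eqP => [->|_]; last by rewrite !scale0r.
by rewrite -conjgM mulgV conjg1 mulgV invgK.
Qed.

HB.instance Definition _ := isHopf.Build k DGdual
  DGdual_comul_linear DGdual_counit_linear DGdual_antipode_linear
  DGdual_coassoc DGdual_counitl DGdual_counitr DGdual_comul1 DGdual_comulM
  DGdual_counit_monoid DGdual_antipodel DGdual_antipoder.

End DoubleDual.

Section Components.
Variables (k : fieldType) (G : finGroupType) (sigma : reg2 (DGdual k G)).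

Definition beta_of (g h : G) : k := sigma (cross g 1) (cross h 1).

Definition alpha_of (f f' : funalg k G) : k :=
  sigma (cross 1%g f) (cross 1%g f').

Definition lambda_of (g : G) (f : funalg k G) : k :=
  \sw_(f1, f2 <- Delta (cross 1%g f)) \sw_(g1, g2 <- Delta (cross g 1))
    (reg2_inv sigma f1 g1 * sigma g2 f2).

Lemma cross_sum x (f : funalg k G) :
  cross x f = \sum_y f y *: cross x (dlt k y).
Proof.
rewrite [LHS]DGdual_sum exchange_big; apply: eq_bigr => y _ /=.
rewrite (bigD1 x) //= [X in _ + X]big1 ?addr0 => [|u /negPf uN].
  by rewrite ffunE eqxx mul1r.
by rewrite ffunE [x == _]eq_sym uN mul0r scale0r.
Qed.

Lemma lambda_ofE g (f : funalg k G) : lambda_of g f = \sum_t \sum_x \sum_y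
  f (x * y)%g * (reg2_inv sigma (cross 1%g (dlt k x)) (cross g (dlt k t)) *
  sigma (cross (t^-1 * g * t)%g 1) (cross 1%g (dlt k y))).
Proof.
have bS (tau : {biscalar DGdual k G}) : biscalar_map tau.
  by split=> u c v w; rewrite ?linearPl ?linearPr.
have [Sl Sr] := bS sigma; have [Il Ir] := bS (reg2_inv sigma).
have sumr0 h (u v : DGdual k G) :
    \sw_(g1, g2 <- Delta (cross h 1)) (reg2_inv sigma u g1 * sigma g2 v) =
    \sum_t reg2_inv sigma u (cross h (dlt k t)) * sigma (cross (h ^ t)%g 1) v.
  rewrite [LHS]DGdual_sw_cross; last first.
    split=> w c a b /=; first by rewrite Ir mulrDl mulrA.
    by rewrite Sl mulrDr mulrCA.
  apply: eq_bigr => t _; rewrite [in RHS](cross_sum (h ^ t)%g).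
  rewrite [X in _ = _ * X](scalar_fsum _ (Sl v)) mulr_sumr.
  apply: eq_bigr => z _.
  by rewrite [X in _ = _ * X](scalar_fZ (Sl v)) !ffunE !mul1r.
rewrite /lambda_of [LHS]DGdual_sw_cross; last first.
  split=> w c a b /=; rewrite !sumr0 mulr_sumr -big_split /=.
    by apply: eq_bigr => t _; rewrite Il mulrDl mulrA.
  by apply: eq_bigr => t _; rewrite Sr mulrDr mulrCA.
rewrite [RHS]exchange_big; apply: eq_bigr => x _.
rewrite [RHS]exchange_big; apply: eq_bigr => y _.
rewrite sumr0 mulr_sumr; apply: eq_bigr => t _.
by rewrite conj1g conjgE mulgA.
Qed.

End Components.

(* Main.v *)
(* A lazy cocycle sigma deforms the product of DG^* into
   a . b = sigma(a1, b1) a2 b2, and sigma = d chi exactly when chi is a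
   convolution-invertible character of the deformed algebra.  Laziness gives
   (g \times 1) . (h \times 1) = beta(g, h) (gh \times 1), triviality of lambda
   makes g \times 1 and 1 \times f commute, and the products
   (g \times 1) . (1 \times e_x) form a basis.  So, if b and a trivialise beta and
   alpha, then chi((g \times 1) . (1 \times f)) = b(g) a(f) defines a character; it
   is the convolution product of b, of g \times f |-> sigma^-1(g \times 1, 1 \times f)
   and of a, hence invertible.

   For the second half, let G be the Heisenberg group over F_2 and let b be the
   sign of the corner entry off the centre, and 1 on the centre.  Then b(g^s)/b(g)
   is the commutator sign of s and g, which is a character in g, so d b is
   conjugation invariant and its pullback along DG^* -> kG is a lazy cocycle.  If it
   were d mu with mu lazy, g |-> mu(g \times 1) would be a class function with
   coboundary d b, so that b(gh) = b(hg) for all g, h. *)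

Require Import Defs.
From HB Require Import structures.
From mathcomp Require Import all_boot all_order all_algebra all_fingroup.
From mathcomp Require Import sesquilinear ring.

Set Implicit Arguments.
Unset Strict Implicit.
Unset Printing Implicit Defensive.

Import GRing.Theory.
Local Open Scope ring_scope.

(** * Sweedler sums and linear forms on them *)

Section Sweedler.
Variables (U U' : Type) (V : nmodType).

Lemma eq_sw (s : seq (U * U)) (F F' : U -> U -> V) : F =2 F' ->
  sweedler s F = sweedler s F'.
Proof. by move=> FF'; apply: eq_bigr => p _; apply: FF'. Qed.

Lemma exchange_sw (s : seq (U * U)) (t : seq (U' * U'))
    (F : U -> U -> U' -> U' -> V) :
  \sw_(a1, a2 <- s) \sw_(b1, b2 <- t) F a1 a2 b1 b2 =
  \sw_(b1, b2 <- t) \sw_(a1, a2 <- s) F a1 a2 b1 b2.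
Proof. exact: exchange_big. Qed.

End Sweedler.

Lemma sw_mulr (U : Type) (R : pzSemiRingType) s (F : U -> U -> R) c :
  sweedler s F * c = \sw_(a1, a2 <- s) (F a1 a2 * c).
Proof. exact: mulr_suml. Qed.

Lemma sw_mull (U : Type) (R : pzSemiRingType) s (F : U -> U -> R) c :
  c * sweedler s F = \sw_(a1, a2 <- s) (c * F a1 a2).
Proof. exact: mulr_sumr. Qed.

Section Scalar.
Variables (k : fieldType) (U : lmodType k).
Implicit Type f : U -> k.

Lemma scalar_mulr f c : scalar f -> scalar (fun u => f u * c).
Proof. by move=> fL d u v; rewrite fL mulrDl mulrA. Qed.

Lemma scalar_mull f c : scalar f -> scalar (fun u => c * f u).
Proof. by move=> fL d u v; rewrite fL mulrDr mulrCA. Qed.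

Lemma scalar_sum (I : Type) (r : seq I) (P : pred I) (F : I -> U -> k) :
  (forall i, scalar (F i)) -> scalar (fun u => \sum_(i <- r | P i) F i u).
Proof.
move=> FL c u v; rewrite mulr_sumr -big_split /=.
by apply: eq_bigr => i _; apply: FL.
Qed.

Lemma scalar_sw (T : Type) (s : seq (T * T)) (F : U -> T -> T -> k) :
    (forall t1 t2, scalar (fun u => F u t1 t2)) ->
  scalar (fun u => \sw_(t1, t2 <- s) F u t1 t2).
Proof. by move=> FL; apply: scalar_sum => p; apply: FL. Qed.

Lemma scalar_comp (W : lmodType k) (h : W -> U) f :
  linear h -> scalar f -> scalar (fun w => f (h w)).
Proof. by move=> hL fL c u v; rewrite hL fL. Qed.

(** The instance of [scalar_comp] where the form is a section of a two-variable map, kept apart so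
    that unification finds it. *)
Lemma scalar_comp2l (W : lmodType k) (T : Type) (h : W -> U)
    (F : U -> T -> k) t :
  linear h -> scalar (F^~ t) -> scalar (fun w => F (h w) t).
Proof. exact: (@scalar_comp W h (F^~ t)). Qed.

Lemma scalar_fD f u v : scalar f -> f (u + v) = f u + f v.
Proof. by move=> fL; rewrite -[u]scale1r fL mul1r scale1r. Qed.

Lemma scalar_fsw (T : Type) (s : seq (T * T)) (F : T -> T -> U) f :
  scalar f -> f (sweedler s F) = \sw_(t1, t2 <- s) f (F t1 t2).
Proof.
move=> fL; apply: (big_morph f) => [u v|]; last exact: scalar_f0.
exact: scalar_fD.
Qed.

End Scalar.

Section LinearAlgebra.
Variables (k : fieldType) (U : lmodType k) (A : algType k).

Lemma linear_mulr (h : U -> A) c : linear h -> linear (fun u => h u * c).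
Proof. by move=> hL d a b; rewrite hL mulrDl scalerAl. Qed.

Lemma linear_mull (h : U -> A) c : linear h -> linear (fun u => c * h u).
Proof. by move=> hL d a b; rewrite hL mulrDr scalerAr. Qed.

End LinearAlgebra.

Ltac linear_tac :=
  first [ apply: linear_mulr; linear_tac | apply: linear_mull; linear_tac
        | by [] ].

(** Since coproducts are lists of pure tensors, [coassoc], [comulM] and [comul1] hold only under
    multilinear maps; this discharges that side condition. *)
Ltac multilinear :=
  intros; cbv beta; first
  [ assumption
  | match goal with H : forall _, _ |- _ => solve [apply: H] end
  | exact: counit_linear
  | apply: scalar_sw; multilinear
  | apply: comul_linear; split; multilinear
  | apply: scalar_mulr; multilinear
  | apply: scalar_mull; multilinear
  | split; multilinear
  | apply: scalar_comp; [linear_tac | multilinear]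
  | apply: scalar_comp2l; [linear_tac | multilinear] ].

(** * The convolution algebras Hom(H, k) and Hom(H ⊗ H, k) *)

Section Convolution.
Variables (k : fieldType) (H : hopfType k).
Implicit Types (f g : H -> k) (s t u : H -> H -> k).

Definition conv f g (a : H) := \sw_(a1, a2 <- Delta a) (f a1 * g a2).

Definition conv2 s t (a b : H) :=
  \sw_(a1, a2 <- Delta a) \sw_(b1, b2 <- Delta b) (s a1 b1 * t a2 b2).

Definition counit2 (a b : H) : k := counit a * counit b.

Lemma eq_conv f f' g g' : f =1 f' -> g =1 g' -> conv f g =1 conv f' g'.
Proof. by move=> ff' gg' a; apply: eq_sw => a1 a2; rewrite ff' gg'. Qed.

Lemma eq_conv2 s s' t t' : s =2 s' -> t =2 t' -> conv2 s t =2 conv2 s' t'.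
Proof.
move=> ss' tt' a b; apply: eq_sw => a1 a2; apply: eq_sw => b1 b2.
by rewrite ss' tt'.
Qed.

Lemma conv_scalar f g : scalar f -> scalar g -> scalar (conv f g).
Proof. by move=> fL gL; apply: comul_linear; multilinear. Qed.

Lemma conv2_biscalar s t :
  biscalar_map s -> biscalar_map t -> biscalar_map (conv2 s t).
Proof.
by move=> [s1 s2] [t1 t2]; split=> [b|a]; rewrite /conv2; multilinear.
Qed.

Lemma convA f g h : scalar f -> scalar g -> scalar h ->
  conv (conv f g) h =1 conv f (conv g h).
Proof.
move=> fL gL hL a; rewrite /conv.
under eq_sw => a1 a2 do rewrite sw_mulr.
under [RHS]eq_sw => a1 a2 do rewrite sw_mull.
rewrite (@coassoc _ _ (fun x y z => f x * g y * h z)); last by multilinear.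
by apply: eq_sw => a1 a2; apply: eq_sw => b1 b2; rewrite mulrA.
Qed.

Lemma conv1l f : scalar f -> conv counit f =1 f.
Proof.
move=> fL a; rewrite -[in RHS](counitl a) scalar_fsw //.
by apply: eq_sw => a1 a2; rewrite scalar_fZ.
Qed.

Lemma conv1r f : scalar f -> conv f counit =1 f.
Proof.
move=> fL a; rewrite -[in RHS](counitr a) scalar_fsw //.
by apply: eq_sw => a1 a2; rewrite scalar_fZ // mulrC.
Qed.

Lemma conv2_1l s : biscalar_map s -> conv2 counit2 s =2 s.
Proof.
move=> [sl sr] a b; rewrite -[RHS](conv1l (sl b)); apply: eq_sw => a1 a2.
rewrite -[in RHS](conv1l (sr a2)) /conv sw_mull; apply: eq_sw => b1 b2.
by rewrite mulrA.
Qed.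

Lemma conv2_1r s : biscalar_map s -> conv2 s counit2 =2 s.
Proof.
move=> [sl sr] a b; rewrite -[RHS](conv1r (sl b)); apply: eq_sw => a1 a2.
rewrite -[in RHS](conv1r (sr a1)) /conv sw_mulr; apply: eq_sw => b1 b2.
by rewrite /counit2 mulrAC mulrA.
Qed.

(** Coassociativity is used on [b] under the sums over [a], then on [a]. *)
Lemma conv2A s t u : biscalar_map s -> biscalar_map t -> biscalar_map u ->
  conv2 (conv2 s t) u =2 conv2 s (conv2 t u).
Proof.
move=> [sl sr] [tl tr] [ul ur] a b; rewrite /conv2.
transitivity (\sw_(a1, a2 <- Delta a) \sw_(a11, a12 <- Delta a1)
  \sw_(b1, b2 <- Delta b) \sw_(b11, b12 <- Delta b1)
    (s a11 b11 * t a12 b12 * u a2 b2)).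
  apply: eq_sw => a1 a2; rewrite exchange_sw; apply: eq_sw => b1 b2.
  by rewrite sw_mulr; apply: eq_sw => a11 a12; rewrite sw_mulr.
transitivity (\sw_(a1, a2 <- Delta a) \sw_(a11, a12 <- Delta a1)
  \sw_(b1, b2 <- Delta b) \sw_(b21, b22 <- Delta b2)
    (s a11 b1 * t a12 b21 * u a2 b22)).
  apply: eq_sw => a1 a2; apply: eq_sw => a11 a12.
  rewrite (@coassoc _ _ (fun x y z => s a11 x * t a12 y * u a2 z)) //.
  by multilinear.
rewrite (@coassoc _ _ (fun x y z => \sw_(b1, b2 <- Delta b)
  \sw_(b21, b22 <- Delta b2) (s x b1 * t y b21 * u z b22))); last first.
  by multilinear.
apply: eq_sw => a1 a2; rewrite exchange_sw; apply: eq_sw => b1 b2.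
rewrite sw_mull; apply: eq_sw => a21 a22; rewrite sw_mull.
by apply: eq_sw => b21 b22; rewrite mulrA.
Qed.

End Convolution.

(** * Coboundaries as convolution identities *)

Section Coboundary.
Variables (k : fieldType) (H : hopfType k).
Implicit Types (f g : H -> k) (s t : H -> H -> k).

Definition on_mul f (a b : H) := f (a * b).
Definition tensor f g (a b : H) := f a * g b.

Lemma on_mul_biscalar f : scalar f -> biscalar_map (on_mul f).
Proof. by move=> fL; rewrite /on_mul; multilinear. Qed.

Lemma tensor_biscalar f g : scalar f -> scalar g -> biscalar_map (tensor f g).
Proof. by move=> fL gL; rewrite /tensor; multilinear. Qed.

Lemma scalar_biscalar (s : {biscalar H}) : biscalar_map s.
Proof. by split=> u c v w; rewrite ?linearPl ?linearPr. Qed.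

Lemma scalar_scalar (f : {scalar H}) : scalar f.
Proof. exact: linearP. Qed.

(** The coproduct is multiplicative, so precomposition with the product of H respects
    convolution. *)
Lemma conv2_on_mul f g : scalar f -> scalar g ->
  conv2 (on_mul f) (on_mul g) =2 on_mul (conv f g).
Proof.
move=> fL gL a b; rewrite /on_mul /conv (@comulM _ _ (fun x y => f x * g y)) //.
by multilinear.
Qed.

Lemma on_mul_counit : on_mul counit =2 @counit2 k H.
Proof. by move=> a b; rewrite /on_mul (@counit_monoid _ H).2. Qed.

Lemma coboundaryE (eta : reg1 H) :
  coboundary eta =2 conv2 (tensor eta eta) (on_mul (reg1_inv eta)).
Proof. by []. Qed.

Lemma conv_reg1_mulV (eta : reg1 H) : conv eta (reg1_inv eta) =1 counit.
Proof. exact: reg1_mulV. Qed.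

Lemma conv_reg1_Vmul (eta : reg1 H) : conv (reg1_inv eta) eta =1 counit.
Proof. exact: reg1_Vmul. Qed.

(* In Hom(H \otimes H, k), [s = coboundary eta] reads
   [s = (eta \otimes eta) * (eta \o m)^-1]. *)
Lemma coboundaryP (eta : reg1 H) s : biscalar_map s ->
  s =2 coboundary eta <-> conv2 s (on_mul eta) =2 tensor eta eta.
Proof.
move=> sB; set eta' := reg1_inv eta.
have eL := scalar_scalar eta; have e'L := scalar_scalar eta'.
have mB := on_mul_biscalar eL; have m'B := on_mul_biscalar e'L.
have tB := tensor_biscalar eL eL.
split=> E a b.
  rewrite (eq_conv2 (t' := on_mul eta) E) //.
  rewrite (eq_conv2 (t' := on_mul eta) (coboundaryE eta)) // conv2A //.
  rewrite (eq_conv2 (s' := tensor eta eta) (t' := counit2 (H := H))) //.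
    exact: conv2_1r.
  move=> x y; rewrite conv2_on_mul // /on_mul conv_reg1_Vmul.
  exact: on_mul_counit.
rewrite coboundaryE -(eq_conv2 (t := on_mul eta') E) // conv2A //.
rewrite (eq_conv2 (s' := s) (t' := counit2 (H := H))) ?conv2_1r //.
move=> x y; rewrite conv2_on_mul // /on_mul conv_reg1_mulV.
exact: on_mul_counit.
Qed.

Definition pack_scalar f (fL : scalar f) : {scalar H} :=
  HB.pack f (GRing.isLinear.Build k H k *%R f fL).

Definition pack_biscalar s (sB : biscalar_map s) : {biscalar H} :=
  HB.pack s (@bilinear_isBilinear.Build k H H k *%R *%R s (proj1 sB, proj2 sB)).

End Coboundary.

(** * The product deformed by a cocycle, and laziness as centrality *)

Section TwistedProduct.
Variables (k : fieldType) (H : hopfType k).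
Implicit Types (f : H -> k) (s : H -> H -> k) (sigma : reg2 H).

Definition twist s (a b : H) : H :=
  \sw_(a1, a2 <- Delta a) \sw_(b1, b2 <- Delta b) (s a1 b1 *: (a2 * b2)).

Lemma scalar_twist f s a b : scalar f ->
  f (twist s a b) = conv2 s (on_mul f) a b.
Proof.
move=> fL; rewrite scalar_fsw //; apply: eq_sw => a1 a2.
by rewrite scalar_fsw //; apply: eq_sw => b1 b2; rewrite scalar_fZ.
Qed.

(** Associativity of the deformed product, tested on a form [f]. Both sides are sums of two values
    of [sigma] times a value of [f] on a triple product, and the cocycle identity exchanges the two
    values of [sigma]. *)
Lemma scalar_twistA f sigma a b c : scalar f -> is_cocycle sigma ->
  f (twist sigma (twist sigma a b) c) = f (twist sigma a (twist sigma b c)).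
Proof.
move=> fL sigmaC; have sB := scalar_biscalar sigma.
have mB := on_mul_biscalar fL; have TB := conv2_biscalar sB mB.
rewrite (scalar_twist _ (twist _ _ _) c fL) (scalar_twist _ a _ fL).
set T := conv2 sigma (on_mul f).
have -> : T (twist sigma a b) c = conv2 sigma (on_mul (T^~ c)) a b.
  by rewrite -(scalar_twist _ _ _ (proj1 TB c)).
have -> : T a (twist sigma b c) = conv2 sigma (on_mul (T a)) b c.
  by rewrite -(scalar_twist _ _ _ (proj2 TB a)).
(* The three coproducts are regrouped so that the inner sum is the left side of the cocycle identity
   at (a1, b1, c1). *)
transitivity (\sw_(a1, a2 <- Delta a) \sw_(b1, b2 <- Delta b)
    \sw_(c1, c2 <- Delta c)
  ((\sw_(a11, a12 <- Delta a1) \sw_(b11, b12 <- Delta b1)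
    (sigma a11 b11 * sigma (a12 * b12) c1)) * f (a2 * b2 * c2))).
  transitivity (\sw_(a1, a2 <- Delta a) \sw_(a21, a22 <- Delta a2)
      \sw_(b1, b2 <- Delta b) \sw_(b21, b22 <- Delta b2)
      \sw_(c1, c2 <- Delta c)
    (sigma a1 b1 * sigma (a21 * b21) c1 * f (a22 * b22 * c2))).
    apply: eq_sw => a1 a2; rewrite exchange_sw; apply: eq_sw => b1 b2.
    rewrite /on_mul [T _ _](@comulM _ _ (fun x y => \sw_(c1, c2 <- Delta c)
      (sigma x c1 * f (y * c2)))); last by case: sB => *; multilinear.
    rewrite sw_mull; apply: eq_sw => a21 a22; rewrite sw_mull.
    apply: eq_sw => b21 b22; rewrite sw_mull; apply: eq_sw => c1 c2.
    by rewrite mulrA.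
  rewrite -(@coassoc _ _ (fun x y z => \sw_(b1, b2 <- Delta b)
      \sw_(b21, b22 <- Delta b2) \sw_(c1, c2 <- Delta c)
    (sigma x b1 * sigma (y * b21) c1 * f (z * b22 * c2)))); last first.
    by case: sB => *; multilinear.
  apply: eq_sw => a1 a2.
  under eq_sw => a11 a12.
    rewrite -(@coassoc _ _ (fun x y z => \sw_(c1, c2 <- Delta c)
      (sigma a11 x * sigma (a12 * y) c1 * f (a2 * z * c2)))); last first.
      by case: sB => *; multilinear.
    over.
  rewrite exchange_sw; apply: eq_sw => b1 b2.
  under eq_sw => a11 a12 do rewrite exchange_sw.
  rewrite exchange_sw; apply: eq_sw => c1 c2; rewrite sw_mulr.
  by apply: eq_sw => a11 a12; rewrite sw_mulr.
under eq_sw => a1 a2 do under eq_sw => b1 b2 do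
  under eq_sw => c1 c2 do rewrite sigmaC.
under [RHS]eq_sw => b1 b2 do under eq_sw => c1 c2 do
  rewrite [on_mul _ _ _]/(T a (b2 * c2)) /T /conv2.
(* After the cocycle identity, coassociativity in [b] and in [c] gathers the factors that form b .
   c. *)
transitivity (\sw_(b1, b2 <- Delta b) \sw_(b11, b12 <- Delta b1)
    \sw_(c1, c2 <- Delta c) \sw_(c11, c12 <- Delta c1)
    \sw_(a1, a2 <- Delta a)
  (sigma b11 c11 * sigma a1 (b12 * c12) * f (a2 * (b2 * c2)))).
  rewrite exchange_sw; apply: eq_sw => b1 b2.
  rewrite exchange_sw; under eq_sw => c1 c2.
    under eq_sw => a1 a2 do (rewrite sw_mulr; under eq_sw => b11 b12 do
      rewrite sw_mulr).
    rewrite exchange_sw; under eq_sw => b11 b12 do rewrite exchange_sw.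
    over.
  rewrite exchange_sw; apply: eq_sw => b11 b12; apply: eq_sw => c1 c2.
  by apply: eq_sw => c11 c12; apply: eq_sw => a1 a2; rewrite mulrA.
rewrite (@coassoc _ _ (fun x y z => \sw_(c1, c2 <- Delta c)
    \sw_(c11, c12 <- Delta c1) \sw_(a1, a2 <- Delta a)
  (sigma x c11 * sigma a1 (y * c12) * f (a2 * (z * c2))))); last first.
  by case: sB => *; multilinear.
apply: eq_sw => b1 b2; rewrite [RHS]/=.
under eq_sw => b21 b22.
  rewrite (@coassoc _ _ (fun x y z => \sw_(a1, a2 <- Delta a)
    (sigma b1 x * sigma a1 (b21 * y) * f (a2 * (b22 * z))))); last first.
    by case: sB => *; multilinear.
  over.
rewrite exchange_sw; apply: eq_sw => c1 c2.
under eq_sw => b21 b22 do rewrite exchange_sw.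
rewrite exchange_sw sw_mull; apply: eq_sw => a1 a2.
rewrite /on_mul (@comulM _ _ (fun x y => sigma a1 x * f (a2 * y))); last first.
  by case: sB => *; multilinear.
rewrite sw_mull; apply: eq_sw => b21 b22; rewrite sw_mull.
by apply: eq_sw => c21 c22; rewrite [RHS]mulrA.
Qed.

Lemma scalar_twist1l f sigma c : scalar f -> f (twist sigma 1 c) = f c.
Proof.
move=> fL; rewrite scalar_twist // /conv2 comul1; last first.
  by case: (scalar_biscalar sigma) => s1 s2; rewrite /on_mul; multilinear.
rewrite -[RHS]conv1l //; apply: eq_sw => c1 c2.
by rewrite reg2_unitl /on_mul mul1r.
Qed.

(** Laziness tested on linear forms. It makes sense for a bare map, hence also for the convolution
    inverse of a lazy cochain. *)
Definition central2 s := forall f, scalar f ->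
  conv2 s (on_mul f) =2 conv2 (on_mul f) s.

Lemma lazy2_central sigma : lazy2 sigma -> central2 sigma.
Proof.
move=> sigmaL f fL a b; rewrite -scalar_twist // [twist _ _ _]sigmaL.
rewrite scalar_fsw //; apply: eq_sw => a1 a2.
by rewrite scalar_fsw //; apply: eq_sw => b1 b2; rewrite scalar_fZ // mulrC.
Qed.

Lemma conv2_reg2_mulV sigma : conv2 sigma (reg2_inv sigma) =2 @counit2 k H.
Proof. exact: reg2_mulV. Qed.

Lemma conv2_reg2_Vmul sigma : conv2 (reg2_inv sigma) sigma =2 @counit2 k H.
Proof. exact: reg2_Vmul. Qed.

(** What commutes with a unit commutes with its inverse: with m = [on_mul f], s' m = s' m s s' = s'
    s m s' = m s'. *)
Lemma lazy2_central_inv sigma : lazy2 sigma -> central2 (reg2_inv sigma).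
Proof.
move=> sigmaL f fL; have sigmaZ := lazy2_central sigmaL fL.
set s' := reg2_inv sigma => a b.
have sB := scalar_biscalar sigma; have s'B := scalar_biscalar s'.
have mB := on_mul_biscalar fL; have cB := conv2_biscalar.
rewrite -(conv2_1r (cB _ _ _ _ s'B mB)).
rewrite -(eq_conv2 (s := conv2 s' (on_mul f)) _ (conv2_reg2_mulV sigma)) //.
rewrite -conv2A //; last exact: cB.
rewrite (eq_conv2 (s' := on_mul f) (t' := s')) // => x y.
rewrite conv2A // -(eq_conv2 (s := s') _ sigmaZ) // -conv2A //.
by rewrite (eq_conv2 (conv2_reg2_Vmul sigma) (t' := on_mul f)) // conv2_1l.
Qed.

End TwistedProduct.

(** * Units of Hom(H, k) *)

Section ConvolutionUnits.
Variables (k : fieldType) (H : hopfType k).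
Implicit Types (f g : H -> k).

Definition inverse_pair f f' :=
  [/\ scalar f, scalar f', conv f f' =1 counit & conv f' f =1 counit].

Lemma inverse_pair_conv f f' g g' : inverse_pair f f' -> inverse_pair g g' ->
  inverse_pair (conv f g) (conv g' f').
Proof.
have half (x x' y y' : H -> k) : inverse_pair x x' -> inverse_pair y y' ->
    conv (conv x y) (conv y' x') =1 counit.
  move=> [xL x'L xx' _] [yL y'L yy' _] a.
  rewrite convA //; last exact: conv_scalar.
  rewrite (eq_conv (f' := x) (g' := x')) // => b.
  by rewrite -convA // (eq_conv yy' (g' := x')) // conv1l.
move=> [fL f'L ff' f'f] [gL g'L gg' g'g]; split; try exact: conv_scalar.
  exact: half.
by apply: half.
Qed.

Lemma reg1_of f f' : inverse_pair f f' -> f 1 = 1 ->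
  exists mu : reg1 H, mu =1 f.
Proof.
move=> [fL f'L ff' f'f] f1.
by exists (@Reg1 k H (pack_scalar fL) (pack_scalar f'L) f1 ff' f'f).
Qed.

Lemma counit_inverse_pair : inverse_pair (@counit k H) counit.
Proof.
have cL := @counit_linear k H.
by split=> // a; rewrite conv1l.
Qed.

End ConvolutionUnits.

(** * Convolution and laziness on the basis of DG^* *)

Section DoubleDualCochains.
Variables (k : fieldType) (G : finGroupType).
Local Notation H := (DGdual k G).
Local Notation E x y := (cross x (dlt k y) : DGdual k G).
Local Notation "x %:G" := (cross x (1 : funalg k G) : DGdual k G)
  (at level 2, format "x %:G").
Implicit Types (s t : H -> H -> k) (g h u x y z : G).

Lemma sw_comul_dlt (F : H -> H -> k) g x : biscalar_map F ->
  \sw_(a1, a2 <- Delta (E g x)) F a1 a2 =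
  \sum_y F (E g y) (E (g ^ y)%g (y^-1 * x)%g).
Proof. exact: DGdual_sw_dlt. Qed.

Lemma sum_dlt : \sum_y dlt k y = 1 :> funalg k G.
Proof.
by rewrite [RHS]funalg_sum; apply: eq_bigr => y _; rewrite ffunE scale1r.
Qed.

Lemma cross_linear g : linear (@cross k G g).
Proof. by move=> c f f'; apply/ffunP=> p; rewrite !ffunE /= mulrDr mulrCA. Qed.

Lemma cross_one g : g%:G = \sum_y E g y.
Proof.
by rewrite [LHS]cross_sum; apply: eq_bigr => y _; rewrite ffunE scale1r.
Qed.

(** Summing out the second index leaves [(g ^ y)%g%:G] on the right; so [g%:G] is not group-like
    unless [g] is central. *)
Lemma sw_comul_one (F : H -> H -> k) g : biscalar_map F ->
  \sw_(a1, a2 <- Delta g%:G) F a1 a2 = \sum_y F (E g y) (g ^ y)%g%:G.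
Proof.
move=> FB; rewrite [LHS](DGdual_sw_cross _ _ FB); apply: eq_bigr => y _.
rewrite [in RHS](cross_one (g ^ y)%g) (scalar_fsum _ (proj2 FB _)).
by apply: eq_bigr => z _; rewrite ffunE mul1r.
Qed.

Definition entry (p : G * G) (a : H) : k := a p.

Lemma entry_scalar p : scalar (entry p).
Proof. by move=> c a b; rewrite /entry !ffunE. Qed.

Lemma entryM g h (f f' : funalg k G) u y :
  entry (u, y) (cross g f * cross h f') = ((g * h)%g == u)%:R * (f y * f' y).
Proof. by rewrite /entry crossM !ffunE. Qed.

Lemma conv2_one_dlt s t g z : biscalar_map s -> biscalar_map t ->
  conv2 s t g%:G (E 1%g z) = \sum_y \sum_x
    s (E g y) (E 1%g x) * t (g ^ y)%g%:G (E 1%g (x^-1 * z)%g).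
Proof.
move=> [s1 s2] [t1 t2]; rewrite [LHS]sw_comul_one; last by multilinear.
apply: eq_bigr => y _; rewrite sw_comul_dlt; last by multilinear.
by apply: eq_bigr => x _; rewrite conj1g.
Qed.

Lemma conv2_dlt_one s t g z : biscalar_map s -> biscalar_map t ->
  conv2 s t (E 1%g z) g%:G = \sum_x \sum_y
    s (E 1%g x) (E g y) * t (E 1%g (x^-1 * z)%g) (g ^ y)%g%:G.
Proof.
move=> [s1 s2] [t1 t2]; rewrite [LHS]sw_comul_dlt; last by multilinear.
apply: eq_bigr => x _; rewrite sw_comul_one; last by multilinear.
by apply: eq_bigr => y _; rewrite conj1g.
Qed.

Lemma conv2_one_one s t g h : biscalar_map s -> biscalar_map t ->
  conv2 s t g%:G h%:G = \sum_x \sum_y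
    s (E g x) (E h y) * t (g ^ x)%g%:G (h ^ y)%g%:G.
Proof.
move=> [s1 s2] [t1 t2]; rewrite [LHS]sw_comul_one; last by multilinear.
by apply: eq_bigr => x _; rewrite sw_comul_one; last by multilinear.
Qed.

Section Central.
Variables (s : H -> H -> k) (sB : biscalar_map s) (sZ : central2 s).

(* Reading laziness at (g \times 1, 1 \times e_(xy)) on the coefficient (u, y). *)
Lemma central2_one_dlt g u x y :
  \sum_w ((g ^ w)%g == u)%:R * s (E g w) (E 1%g x) =
  (g == u)%:R * s (g ^ y)%g%:G (E 1%g (x ^ y)%g).
Proof.
have pB := on_mul_biscalar (entry_scalar (u, y)).
have sZE := sZ (entry_scalar (u, y)) g%:G (E 1%g (x * y)%g).
have {}sZE : \sum_w \sum_z (z == x)%:R *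
      (((g ^ w)%g == u)%:R * s (E g w) (E 1%g z)) =
    \sum_w \sum_z (z == y)%:R * ((w == y)%:R * ((g == u)%:R *
      s (g ^ w)%g%:G (E 1%g (z^-1 * (x * y))%g))).
  transitivity (conv2 s (on_mul (entry (u, y))) g%:G (E 1%g (x * y)%g)).
    rewrite conv2_one_dlt //; apply: eq_bigr => w _; apply: eq_bigr => z _.
    have zE : (z^-1 * (x * y) == y)%g = (z == x).
      by rewrite mulgA -[X in _ == X]mul1g (inj_eq (mulIg y)) -eq_mulVg1.
    by rewrite /on_mul entryM !ffunE mulg1 mul1r zE mulrA mulrC [_%:R * _]mulrC.
  rewrite sZE conv2_one_dlt //; apply: eq_bigr => w _; apply: eq_bigr => z _.
  by rewrite /on_mul entryM !ffunE mulg1; ring.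
transitivity (\sum_w \sum_z (z == x)%:R *
    (((g ^ w)%g == u)%:R * s (E g w) (E 1%g z))).
  by apply: eq_bigr => w _; rewrite sum_delta.
rewrite sZE; under eq_bigr => w _ do rewrite sum_delta.
by rewrite sum_delta conjgE.
Qed.

(** The left side of [central2_one_dlt] does not involve [y]; the case u = g is compared at [y] and
    at 1. *)
Lemma central2_conj g x y :
  s (g ^ y)%g%:G (E 1%g (x ^ y)%g) = s g%:G (E 1%g x).
Proof.
have := central2_one_dlt g g x 1%g; rewrite (central2_one_dlt g g x y).
by rewrite eqxx !mul1r !conjg1.
Qed.

(** Centrality undoes the conjugation of [g]: for fixed [g], the families s(g × 1, 1 × e_x) multiply
    as elements of the group algebra kG. *)
Lemma conv2_central_one_dlt t g z : biscalar_map t -> conv2 s t g%:G (E 1%g z) =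
  \sum_x s g%:G (E 1%g x) * t g%:G (E 1%g (x^-1 * z)%g).
Proof.
move=> tB; rewrite conv2_one_dlt // exchange_big; apply: eq_bigr => x _ /=.
(* Terms are sorted by the conjugate u = g^y; [central2_one_dlt] then kills all but u = g. *)
transitivity (\sum_u \sum_y ((g ^ y)%g == u)%:R * s (E g y) (E 1%g x) *
    t u%:G (E 1%g (x^-1 * z)%g)).
  rewrite exchange_big; apply: eq_bigr => y _ /=.
  rewrite -[LHS](sum_delta_sym (fun u => s _ _ * t u%:G _)).
  by apply: eq_bigr => u _; rewrite mulrA.
under eq_bigr => u _ do rewrite -mulr_suml (central2_one_dlt g u x 1%g) -mulrA.
by rewrite sum_delta_sym !conjg1.
Qed.

End Central.

Lemma scalar_ext (f f' : H -> k) : scalar f -> scalar f' ->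
  (forall g x, f (E g x) = f' (E g x)) -> f =1 f'.
Proof.
move=> fL f'L ff' a; rewrite [a]DGdual_sum !scalar_fsum //.
apply: eq_bigr => g _; rewrite !scalar_fsum //.
by apply: eq_bigr => x _; rewrite !scalar_fZ // ff'.
Qed.

Lemma counit_dlt g x : counit (E g x) = (x == 1%g)%:R.
Proof. by rewrite [LHS]DGdual_counit_cross ffunE. Qed.

Lemma counit_one g : counit g%:G = 1.
Proof. by rewrite [LHS]DGdual_counit_cross ffunE. Qed.

Lemma entryP (a b : H) : (forall u y, entry (u, y) a = entry (u, y) b) -> a = b.
Proof. by move=> ab; apply/ffunP=> -[u y]; apply: ab. Qed.

(** The embedding [cross 1] is a coalgebra map, because conjugation fixes 1. *)
Lemma sw_comul_cross1 (F : H -> H -> k) (f : funalg k G) : biscalar_map F ->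
  \sw_(a1, a2 <- Delta (cross 1%g f : H)) F a1 a2 =
  \sw_(f1, f2 <- Delta f) F (cross 1%g f1) (cross 1%g f2).
Proof.
move=> FB; rewrite [LHS](DGdual_sw_cross _ _ FB) [RHS]funalg_swE; last first.
  case: FB => [F1 F2].
  by split=> u c f1 f2; rewrite cross_linear; [apply: F1 | apply: F2].
by apply: eq_bigr => x _; apply: eq_bigr => y _; rewrite conj1g.
Qed.

Lemma sw_comul_funalg_dlt (F : funalg k G -> funalg k G -> k) x :
  biscalar_map F -> \sw_(f1, f2 <- Delta (dlt k x)) F f1 f2 =
    \sum_y F (dlt k y) (dlt k (y^-1 * x)%g).
Proof.
move=> FB; rewrite [LHS]funalg_swE //; apply: eq_bigr => y _.
rewrite -[RHS](sum_delta_sym (fun z => F (dlt k y) (dlt k z))).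
apply: eq_bigr => z _; rewrite ffunE.
by rewrite -(can2_eq (mulKVg y) (mulKg y)).
Qed.

Section LinearExtension.
Implicit Type w : G -> G -> k.

Definition linext w (a : H) : k := \sum_g \sum_x a (g, x) * w g x.

Lemma linext_scalar w : scalar (linext w).
Proof.
apply: scalar_sum => g; apply: scalar_sum => x; apply: scalar_mulr.
exact: entry_scalar.
Qed.

Lemma linext_cross w g f : linext w (cross g f) = \sum_x f x * w g x.
Proof.
rewrite -[RHS](sum_delta_sym (fun u => \sum_x f x * w u x)).
apply: eq_bigr => u _; rewrite mulr_sumr.
by apply: eq_bigr => x _; rewrite ffunE mulrA.
Qed.

Lemma linext_dlt w g x : linext w (E g x) = w g x.
Proof.
rewrite linext_cross -[RHS](sum_delta_sym (w g)).
by apply: eq_bigr => y _; rewrite ffunE.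
Qed.

Lemma conv_dlt (f f' : H -> k) g x : scalar f -> scalar f' ->
  conv f f' (E g x) = \sum_y f (E g y) * f' (E (g ^ y)%g (y^-1 * x)%g).
Proof. by move=> fL f'L; rewrite [LHS]sw_comul_dlt; last by multilinear. Qed.

Lemma inverse_pair_linext w w' :
    (forall g x, \sum_y w g y * w' (g ^ y)%g (y^-1 * x)%g = (x == 1%g)%:R) ->
    (forall g x, \sum_y w' g y * w (g ^ y)%g (y^-1 * x)%g = (x == 1%g)%:R) ->
  inverse_pair (linext w) (linext w').
Proof.
move=> ww' w'w; have wL := linext_scalar.
split=> //; apply: scalar_ext; try exact: counit_linear; try exact: conv_scalar.
  move=> g x; rewrite conv_dlt // counit_dlt -(ww' g x).
  by apply: eq_bigr => y _; rewrite !linext_dlt.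
move=> g x; rewrite conv_dlt // counit_dlt -(w'w g x).
by apply: eq_bigr => y _; rewrite !linext_dlt.
Qed.

End LinearExtension.

(** * The character of the deformed algebra that trivialises [sigma] *)

Section Character.
Variable sigma : reg2 H.
Hypotheses (sigmaC : is_cocycle sigma) (sigmaL : lazy2 sigma).
Local Notation sigma' := (reg2_inv sigma).
Local Notation "a ** b" := (twist sigma a b) (at level 40).

Let sB : biscalar_map sigma := scalar_biscalar sigma.
Let s'B : biscalar_map sigma' := scalar_biscalar sigma'.
Let sZ : central2 sigma := lazy2_central sigmaL.
Let s'Z : central2 sigma' := lazy2_central_inv sigmaL.

Lemma twistA a b c : (a ** b) ** c = a ** (b ** c).
Proof.
by apply: entryP => u y; apply: scalar_twistA sigmaC; apply: entry_scalar.
Qed.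

Lemma twist1l c : 1 ** c = c.
Proof. by apply: entryP => u y; apply: scalar_twist1l; apply: entry_scalar. Qed.

Lemma entry_twist p a b : entry p (a ** b) = conv2 (on_mul (entry p)) sigma a b.
Proof. by rewrite scalar_twist ?sZ //; apply: entry_scalar. Qed.

(** With [sigma] on the right, the coordinate at (u, y) is [diag]; with [sigma] on the left it does
    not depend on [y]. By laziness they agree, so y = 1 gives the coefficient. *)
Lemma twist_one_one g h : g%:G ** h%:G = beta_of sigma g h *: (g * h)%g%:G.
Proof.
have coordB p := on_mul_biscalar (entry_scalar p).
have diag u y : entry (u, y) (g%:G ** h%:G) =
    ((g * h)%g == u)%:R * sigma (g ^ y)%g%:G (h ^ y)%g%:G.
  rewrite entry_twist conv2_one_one //.
  transitivity (\sum_x \sum_z (z == y)%:R * ((x == y)%:R *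
      (((g * h)%g == u)%:R * sigma (g ^ x)%g%:G (h ^ z)%g%:G))).
    apply: eq_bigr => x _; apply: eq_bigr => z _.
    by rewrite /on_mul entryM !ffunE; ring.
  by under eq_bigr => x _ do rewrite sum_delta; rewrite sum_delta.
apply: entryP => u y; transitivity (entry (u, 1%g) (g%:G ** h%:G)).
  rewrite !scalar_twist ?conv2_one_one //; try exact: entry_scalar.
  apply: eq_bigr => x _; apply: eq_bigr => z _.
  by rewrite /on_mul !entryM !ffunE.
by rewrite diag !conjg1 /entry !ffunE mulr1 [RHS]mulrC.
Qed.

(** With [sigma] on the right, the coefficient of [E g y] is the value at g^y and y^-1 x = (x
    y^-1)^y; [central2_conj] removes the conjugation by [y]. *)
Lemma twist_one_dlt g x :
  g%:G ** E 1%g x = \sum_y sigma g%:G (E 1%g (x * y^-1)%g) *: E g y.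
Proof.
apply: entryP => u y; rewrite entry_twist conv2_one_dlt //; last first.
  exact/on_mul_biscalar/entry_scalar.
rewrite scalar_fsum; last exact: entry_scalar.
transitivity (\sum_z \sum_t (t == y)%:R * ((z == y)%:R * ((g == u)%:R *
    sigma (g ^ z)%g%:G (E 1%g (t^-1 * x)%g)))).
  apply: eq_bigr => z _; apply: eq_bigr => t _.
  by rewrite /on_mul entryM !ffunE mulg1; ring.
under eq_bigr => z _ do rewrite sum_delta.
rewrite sum_delta.
have -> : (y^-1 * x = (x * y^-1) ^ y)%g by rewrite conjgE mulgKV.
rewrite central2_conj // -(sum_delta (fun z => (g == u)%:R *
  sigma g%:G (E 1%g (x * z^-1)%g)) y).
apply: eq_bigr => z _; rewrite scalar_fZ; last exact: entry_scalar.
by rewrite /entry !ffunE /=; ring.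
Qed.

(** For fixed [g], [sigma] and [sigma'] give mutually inverse elements of kG. *)
Lemma sigma_mulV g x : \sum_y sigma g%:G (E 1%g y) *
  sigma' g%:G (E 1%g (y^-1 * x)%g) = (x == 1%g)%:R.
Proof.
rewrite -conv2_central_one_dlt // conv2_reg2_mulV.
by rewrite /counit2 counit_one mul1r counit_dlt.
Qed.

Lemma sigma_Vmul g x : \sum_y sigma' g%:G (E 1%g y) *
  sigma g%:G (E 1%g (y^-1 * x)%g) = (x == 1%g)%:R.
Proof.
rewrite -conv2_central_one_dlt // conv2_reg2_Vmul.
by rewrite /counit2 counit_one mul1r counit_dlt.
Qed.

(** Inverts the change of basis of [twist_one_dlt], so a linear form is determined by its values on
    the products of [g%:G] and [E 1 x]. *)
Lemma cross_dlt_twist g y :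
  E g y = \sum_x sigma' g%:G (E 1%g (y * x^-1)%g) *: (g%:G ** E 1%g x).
Proof.
under eq_bigr => x _ do rewrite twist_one_dlt scaler_sumr.
rewrite exchange_big -[LHS](sum_deltaZ (fun z => E g z) y).
apply: eq_bigr => z _; under eq_bigr => x _ do rewrite scalerA.
rewrite -scaler_suml; congr (_ *: _).
have -> : (z == y) = ((y * z^-1)%g == 1%g) by rewrite eq_sym eq_mulgV1.
rewrite -(sigma_Vmul g) (reindex_inj (inj_comp (mulgI y) invg_inj)) /=.
by apply: eq_bigr => x _; rewrite invMg invgK -mulgA mulKg.
Qed.

Lemma scalar_ext_twist (f f' : H -> k) : scalar f -> scalar f' ->
  (forall g x, f (g%:G ** E 1%g x) = f' (g%:G ** E 1%g x)) -> f =1 f'.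
Proof.
move=> fL f'L ff'; apply: scalar_ext => // g y; rewrite cross_dlt_twist.
by rewrite !scalar_fsum //; apply: eq_bigr => x _; rewrite !scalar_fZ // ff'.
Qed.

Lemma alpha_biscalar : biscalar_map (alpha_of sigma).
Proof.
case: sB => [s1 s2].
by split=> u c f1 f2; rewrite /alpha_of cross_linear; [apply: s1 | apply: s2].
Qed.

Lemma twist_cross1 (f f' : funalg k G) :
  cross 1%g f ** cross 1%g f' = cross 1%g (twist (alpha_of sigma) f f').
Proof.
apply: entryP => u y; set p := (u, y); have pL := entry_scalar p.
have cL : scalar (fun c : funalg k G => entry p (cross 1%g c)).
  exact: scalar_comp (@cross_linear 1%g) pL.
rewrite scalar_twist // [RHS](scalar_twist _ _ _ cL) /conv2.
have [s1 s2] := sB; rewrite sw_comul_cross1; last by multilinear.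
apply: eq_sw => f1 f2; rewrite sw_comul_cross1; last by multilinear.
by apply: eq_sw => f1' f2'; rewrite /on_mul crossM mulg1.
Qed.

(** On the spanning products, (g . e_x) . (h . e_y) = (g . h) . (e_x . e_y) by associativity and
    [comm]; the two factors are then governed by beta and alpha. *)
Lemma twist_coboundary (b : G -> k) (a : reg1 (funalg k G)) (chi : H -> k) :
    scalar chi ->
    (forall g h, beta_of sigma g h * b (g * h)%g = b g * b h) ->
    alpha_of sigma =2 coboundary a ->
    (forall g x, sigma g%:G (E 1%g x) = sigma (E 1%g x) g%:G) ->
    (forall g x, chi (g%:G ** E 1%g x) = b g * a (dlt k x)) ->
  forall c d, chi (c ** d) = chi c * chi d.
Proof.
move=> chiL bM aM sigmaS chiE c d.
have mB := on_mul_biscalar chiL.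
have tB : biscalar_map (fun c d => chi (c ** d)).
  have [t1 t2] := conv2_biscalar sB mB.
  split=> e r u v.
    by rewrite !(scalar_twist _ _ _ chiL); apply: t1.
  by rewrite !(scalar_twist _ _ _ chiL); apply: t2.
(* A general [f] is needed because e_x . e_y need not be a multiple of a basis element. *)
have chiF g f : chi (g%:G ** cross 1%g f) = b g * a f.
  have aL := scalar_scalar a; rewrite [f in LHS]funalg_sum [f in RHS]funalg_sum.
  rewrite (scalar_fsum _ aL) mulr_sumr.
  rewrite (scalar_fsum _ (scalar_comp (@cross_linear 1%g) (proj2 tB g%:G))).
  apply: eq_bigr => x _; rewrite (scalar_fZ aL) crossZ.
  by rewrite [LHS](scalar_fZ (proj2 tB g%:G)) chiE mulrCA.
have comm g x : g%:G ** E 1%g x = E 1%g x ** g%:G.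
  apply: entryP => u y; have pB := on_mul_biscalar (entry_scalar (u, y)).
  rewrite !entry_twist conv2_one_dlt // conv2_dlt_one // exchange_big.
  apply: eq_bigr => z _; apply: eq_bigr => t _.
  rewrite sigmaS /on_mul !entryM mulg1 mul1g.
  by congr (_ * _ * _); rewrite mulrC.
move: c; apply: scalar_ext_twist (proj1 tB d) (scalar_mulr _ chiL) _ => g x.
move: d; apply: scalar_ext_twist (proj2 tB _) (scalar_mull _ chiL) _ => h y.
rewrite twistA -(twistA _ h%:G) -comm (twistA h%:G) -twistA twist_one_one.
rewrite [E 1%g x ** _]twist_cross1 [LHS](scalar_fZ (proj1 tB _)) chiF mulrA bM.
rewrite !chiE (scalar_twist _ _ _ (scalar_scalar a)).
by rewrite ((coboundaryP a alpha_biscalar).1 aM) /tensor mulrACA.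
Qed.

(** At (1 × f, g × 1), lambda is the convolution of [sigma'] with the flip of [sigma]. Multiplying
    by [sigma] on the left recovers the flip; the coproduct of g × 1 calls for lambda at all
    conjugates of [g]. *)
Lemma lambda_trivial_sym :
    (forall g x, lambda_of sigma g (dlt k x) = counit (dlt k x)) ->
  forall g x, sigma g%:G (E 1%g x) = sigma (E 1%g x) g%:G.
Proof.
move=> lambda1 g x; pose flip (c d : H) := sigma d c.
have fB : biscalar_map flip by case: sB => s1 s2; split.
have counitE z : counit (dlt k z) = (z == 1%g)%:R by rewrite [LHS]ffunE.
transitivity (conv2 sigma (conv2 sigma' flip) (E 1%g x) g%:G).
  rewrite -conv2A // (eq_conv2 (conv2_reg2_mulV sigma) (t' := flip)) //.
  by rewrite conv2_1l.
rewrite conv2_dlt_one //; last exact: conv2_biscalar.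
transitivity (\sum_z \sum_y (z == x)%:R * sigma (E 1%g z) (E g y)).
  apply: eq_bigr => z _; apply: eq_bigr => y _.
  rewrite [conv2 _ _ _ _](lambda1 (g ^ y)%g (z^-1 * x)%g) counitE mulrC.
  by rewrite -eq_mulVg1.
under eq_bigr => z _ do rewrite -mulr_sumr.
rewrite (sum_delta (fun z => \sum_y sigma (E 1%g z) (E g y))).
by rewrite [in RHS]cross_one (scalar_fsum _ (proj2 sB _)).
Qed.

Lemma lazy_cocycle_trivial :
    trivial_group_H2 (beta_of sigma) -> trivial_H2 (alpha_of sigma) ->
    (forall g x : G, lambda_of sigma g (dlt k x) = counit (dlt k x)) ->
  trivial_H2 sigma.
Proof.
move=> [b b_neq0 bE] [a aE] /lambda_trivial_sym sigmaS.
have bM g h : beta_of sigma g h * b (g * h)%g = b g * b h.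
  by rewrite bE divfK.
pose bhat := linext (fun g y => b g * (y == 1%g)%:R).
pose bhat' := linext (fun g y => (b g)^-1 * (y == 1%g)%:R).
pose n := linext (fun g y => sigma' g%:G (E 1%g y)).
pose n' := linext (fun g y => sigma g%:G (E 1%g y)).
pose ahat := linext (fun=> fun y => a (dlt k y)).
pose ahat' := linext (fun=> fun y => reg1_inv a (dlt k y)).
(* The inverse laws of kG with the factors exchanged; this order arises from the coproduct of DG^*
   once [central2_conj] and [conjE] turn y^-1 x into x y^-1. *)
have VmulE g x : \sum_y sigma' g%:G (E 1%g y) * sigma g%:G (E 1%g (x * y^-1)%g)
    = (x == 1%g)%:R.
  rewrite -(sigma_mulV g).
  rewrite [RHS](reindex_inj (inj_comp (mulgI x) invg_inj)) /=.
  by apply: eq_bigr => y _; rewrite invMg invgK mulgKV mulrC.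
have mulVE g x : \sum_y sigma g%:G (E 1%g y) * sigma' g%:G (E 1%g (x * y^-1)%g)
    = (x == 1%g)%:R.
  rewrite -(sigma_Vmul g).
  rewrite [RHS](reindex_inj (inj_comp (mulgI x) invg_inj)) /=.
  by apply: eq_bigr => y _; rewrite invMg invgK mulgKV mulrC.
have conjE x y : (y^-1 * x = (x * y^-1) ^ y)%g by rewrite conjgE mulgKV.
have bhatP : inverse_pair bhat bhat'.
  have half (f f' : G -> k) g x : f g * f' g = 1 ->
      \sum_y f g * (y == 1%g)%:R * (f' (g ^ y)%g * ((y^-1 * x)%g == 1%g)%:R) =
      (x == 1%g)%:R.
    move=> ff'; transitivity (\sum_y (y == 1%g)%:R *
        (f g * f' (g ^ y)%g * ((y^-1 * x)%g == 1%g)%:R)).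
      by apply: eq_bigr => y _; ring.
    by rewrite sum_delta conjg1 ff' mul1r invg1 mul1g.
  apply: inverse_pair_linext => g x.
    by rewrite (half b (fun h => (b h)^-1)) ?divff.
  by rewrite (half (fun h => (b h)^-1) b) ?mulVf.
have nP : inverse_pair n n'.
  apply: inverse_pair_linext => g x.
    by rewrite -(VmulE g); apply: eq_bigr => y _; rewrite conjE central2_conj.
  by rewrite -(mulVE g); apply: eq_bigr => y _; rewrite conjE central2_conj.
have ahatP : inverse_pair ahat ahat'.
  have aL := scalar_scalar a; have a'L := scalar_scalar (reg1_inv a).
  apply: inverse_pair_linext => g x.
    rewrite -(@sw_comul_funalg_dlt (fun f f' => a f * reg1_inv a f'));
      last by multilinear.
    by rewrite reg1_mulV [LHS]ffunE.
  rewrite -(@sw_comul_funalg_dlt (fun f f' => reg1_inv a f * a f')); last first.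
    by multilinear.
  by rewrite reg1_Vmul [LHS]ffunE.
pose chi := conv (conv bhat n) ahat.
have chiP := inverse_pair_conv (inverse_pair_conv bhatP nP) ahatP.
have [chiL _ _ _] := chiP; rewrite -/chi in chiP chiL.
have [bnL _ _ _] := inverse_pair_conv bhatP nP.
have [[bL _ _ _] [nL _ _ _]] := (bhatP, nP); have [aL _ _ _] := ahatP.
have chi_dlt g x : chi (E g x) =
    b g * \sum_y sigma' g%:G (E 1%g y) * a (dlt k (y^-1 * x)%g).
  rewrite [LHS]conv_dlt // mulr_sumr; apply: eq_bigr => y _.
  rewrite [ahat _]linext_dlt mulrA; congr (_ * _); rewrite conv_dlt //.
  transitivity (\sum_z (z == 1%g)%:R *
      (b g * sigma' (g ^ z)%g%:G (E 1%g (z^-1 * y)%g))).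
    by apply: eq_bigr => z _; rewrite [bhat _]linext_dlt [n _]linext_dlt; ring.
  by rewrite sum_delta conjg1 invg1 mul1g.
have chiE g x : chi (g%:G ** E 1%g x) = b g * a (dlt k x).
  rewrite twist_one_dlt scalar_fsum //.
  transitivity (\sum_y \sum_t b g * (sigma' g%:G (E 1%g t) *
      sigma g%:G (E 1%g (x * y^-1)%g) * a (dlt k (t^-1 * y)%g))).
    apply: eq_bigr => y _; rewrite scalar_fZ // chi_dlt mulrCA !mulr_sumr.
    by apply: eq_bigr => t _; ring.
  rewrite exchange_big -[RHS](sum_delta (fun w => b g * a (dlt k w)) x) /=.
  (* With w = t^-1 y, the sum over [t] becomes [VmulE] at x w^-1, which forces w = x. *)
  transitivity (\sum_w \sum_t b g * (sigma' g%:G (E 1%g t) *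
      sigma g%:G (E 1%g (x * w^-1 * t^-1)%g) * a (dlt k w))).
    rewrite [RHS]exchange_big; apply: eq_bigr => t _ /=.
    rewrite (reindex_inj (mulgI t)); apply: eq_bigr => w _.
    by rewrite mulKg invMg mulgA.
  apply: eq_bigr => w _; rewrite eq_sym eq_mulgV1 -(VmulE g) mulr_suml.
  by apply: eq_bigr => t _; ring.
have chiM := twist_coboundary chiL bM aE sigmaS chiE.
have chi1 : chi 1 = 1.
  have b1 : b 1%g = 1.
    have := bE 1%g 1%g; rewrite mulg1 mulfK // => <-.
    by rewrite /beta_of reg2_unitl counit_one.
  have one_sum : 1 = \sum_x E 1%g x :> H := cross1 k G.
  rewrite one_sum (scalar_fsum _ chiL) -(reg1_unit a) -sum_dlt.
  rewrite (scalar_fsum _ (scalar_scalar a)); apply: eq_bigr => x _.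
  (* The unit is [1%:G], so [E 1 x] is itself one of the products evaluated by [chiE]. *)
  by rewrite -[E 1%g x in LHS]twist1l chiE b1 mul1r.
have [mu muE] := reg1_of chiP chi1.
exists mu; apply/(coboundaryP mu sB) => c d.
rewrite /tensor !muE -chiM (scalar_twist _ _ _ chiL).
by apply: eq_conv2 => // x y; apply: muE.
Qed.

End Character.
End DoubleDualCochains.

(** * Lazy cocycles inflated from conjugation-invariant coboundaries of G *)

Section Inflation.
Variables (k : fieldType) (G : finGroupType).
Local Notation H := (DGdual k G).
Local Notation E x y := (cross x (dlt k y) : DGdual k G).
Local Notation "x %:G" := (cross x (1 : funalg k G) : DGdual k G)
  (at level 2, format "x %:G").
Implicit Types (c : G -> G -> k) (F : H -> H -> k) (g h u x y z : G).

(* The pullback of c along the Hopf map DG^* -> kG, x \times f |-> f(1) x. *)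
Definition infl c (a b : H) : k := linext (fun g x =>
  linext (fun h y => (x == 1%g)%:R * (y == 1%g)%:R * c g h) b) a.

Lemma infl_biscalar c : biscalar_map (infl c).
Proof.
split=> [b | a]; first exact: linext_scalar.
apply: scalar_sum => g; apply: scalar_sum => x; apply: scalar_mull.
exact: linext_scalar.
Qed.

Lemma infl_cross c g h (f f' : funalg k G) :
  infl c (cross g f) (cross h f') = f 1%g * f' 1%g * c g h.
Proof.
rewrite /infl linext_cross.
transitivity (\sum_x (x == 1%g)%:R * \sum_y (y == 1%g)%:R *
  (f x * f' y * c g h)).
  apply: eq_bigr => x _; rewrite linext_cross !mulr_sumr.
  by apply: eq_bigr => y _; ring.
by rewrite sum_delta sum_delta.
Qed.

Lemma infl_dlt c g h x y :
  infl c (E g x) (E h y) = (x == 1%g)%:R * (y == 1%g)%:R * c g h.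
Proof. by rewrite infl_cross !ffunE. Qed.

Lemma biscalar_ext F F' : biscalar_map F -> biscalar_map F' ->
  (forall g h x y, F (E g x) (E h y) = F' (E g x) (E h y)) -> F =2 F'.
Proof.
move=> [F1 F2] [F1' F2'] FF' a b; move: a; apply: scalar_ext => // g x.
by move: b; apply: scalar_ext => // h y.
Qed.

Lemma conv2_dlt F F' g h x y : biscalar_map F -> biscalar_map F' ->
  conv2 F F' (E g x) (E h y) = \sum_u \sum_z F (E g u) (E h z) *
    F' (E (g ^ u)%g (u^-1 * x)%g) (E (h ^ z)%g (z^-1 * y)%g).
Proof.
move=> [F1 F2] [F1' F2']; rewrite [LHS]sw_comul_dlt; last by multilinear.
by apply: eq_bigr => u _; rewrite sw_comul_dlt; last by multilinear.
Qed.

Lemma conv2_infl_l c F g h x y : biscalar_map F ->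
  conv2 (infl c) F (E g x) (E h y) = c g h * F (E g x) (E h y).
Proof.
move=> FB; rewrite conv2_dlt //; last exact: infl_biscalar.
transitivity (\sum_u (u == 1%g)%:R * \sum_z (z == 1%g)%:R * (c g h *
    F (E (g ^ u)%g (u^-1 * x)%g) (E (h ^ z)%g (z^-1 * y)%g))).
  apply: eq_bigr => u _; rewrite mulr_sumr; apply: eq_bigr => z _.
  by rewrite infl_dlt; ring.
by rewrite sum_delta sum_delta invg1 !mul1g !conjg1.
Qed.

(** Only the terms u = x and z = y survive, and there the right legs of the coproducts carry the
    conjugates g^x and h^y. On the left the factor was c(g, h): laziness is the comparison of the
    two. *)
Lemma conv2_infl_r c F g h x y : biscalar_map F ->
  conv2 F (infl c) (E g x) (E h y) = F (E g x) (E h y) * c (g ^ x)%g (h ^ y)%g.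
Proof.
move=> FB; rewrite conv2_dlt //; last exact: infl_biscalar.
transitivity (\sum_u (u == x)%:R * \sum_z (z == y)%:R * (F (E g u) (E h z) *
    c (g ^ u)%g (h ^ z)%g)).
  apply: eq_bigr => u _; rewrite mulr_sumr; apply: eq_bigr => z _.
  by rewrite infl_dlt -!eq_mulVg1; ring.
by rewrite sum_delta sum_delta.
Qed.

Section CoboundaryInflation.
Variable b : G -> k.
Hypotheses (b_neq0 : forall g, b g != 0) (b1 : b 1%g = 1).
Let c g h : k := b g * b h / b (g * h)%g.
Let c' g h : k := (c g h)^-1.
Hypothesis cJ : forall g h x, c (g ^ x)%g (h ^ x)%g = c g h.

Let c_neq0 g h : c g h != 0.
Proof. by rewrite /c !(mulf_neq0, invr_eq0). Qed.

Let c1g h : c 1%g h = 1.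
Proof. by rewrite /c b1 mul1g mul1r divff. Qed.

Let cg1 h : c h 1%g = 1.
Proof. by rewrite /c b1 mulg1 mulr1 divff. Qed.

Let c_cocycle g h z : c g h * c (g * h)%g z = c h z * c g (h * z)%g.
Proof.
rewrite /c mulgA; have := b_neq0 (g * h)%g; have := b_neq0 (h * z)%g.
by move: (b_neq0 (g * h * z)%g) => *; field; apply/and3P.
Qed.

Let inflB d := infl_biscalar d.

Lemma counit2_biscalar : biscalar_map (@counit2 k H).
Proof. exact: (tensor_biscalar (@counit_linear k H) (@counit_linear k H)). Qed.

Let infl_inv d d' : (forall g h, d g h * d' g h = 1) ->
  conv2 (infl d) (infl d') =2 @counit2 k H.
Proof.
move=> dd'; apply: biscalar_ext => [||g h x y].
- exact: conv2_biscalar.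
- exact: counit2_biscalar.
by rewrite conv2_infl_l // infl_dlt /counit2 !counit_dlt mulrCA dd' mulr1.
Qed.

Let infl_unitl a : infl c 1 a = counit a.
Proof.
move: a; apply: scalar_ext (proj2 (inflB c) _) (@counit_linear k H) _ => g x.
by rewrite [LHS]infl_cross !ffunE c1g mulr1 mul1r counit_dlt.
Qed.

Let infl_unitr a : infl c a 1 = counit a.
Proof.
move: a; apply: scalar_ext (proj1 (inflB c) _) (@counit_linear k H) _ => g x.
by rewrite [LHS]infl_cross !ffunE cg1 !mulr1 counit_dlt.
Qed.

Let infl_mulV : conv2 (infl c) (infl c') =2 @counit2 k H.
Proof. by apply: infl_inv => g h; rewrite divff. Qed.

Let infl_Vmul : conv2 (infl c') (infl c) =2 @counit2 k H.
Proof. by apply: infl_inv => g h; rewrite mulVf. Qed.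

Definition infl_reg2 : reg2 H := @Reg2 k H (pack_biscalar (inflB c))
  (pack_biscalar (inflB c')) infl_unitl infl_unitr infl_mulV infl_Vmul.

Lemma infl_cocycle : is_cocycle infl_reg2.
Proof.
move=> a1 a2 a3.
have m1 a : biscalar_map (on_mul ((infl c)^~ a)).
  exact/on_mul_biscalar/(proj1 (inflB c)).
have m2 a : biscalar_map (on_mul (infl c a)).
  exact/on_mul_biscalar/(proj2 (inflB c)).
rewrite -[LHS]/(conv2 (infl c) (on_mul ((infl c)^~ a3)) a1 a2).
rewrite -[RHS]/(conv2 (infl c) (on_mul (infl c a1)) a2 a3).
have L1 := conv2_biscalar (inflB c) (m1 _).
have L2 := conv2_biscalar (inflB c) (m2 _).
have [i1 i2] := inflB c.
move: a1; apply: scalar_ext; [exact: (proj1 (L1 _)) | | move=> g x].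
  by rewrite /conv2 /on_mul; multilinear.
move: a2; apply: scalar_ext; [exact: (proj2 (L1 _)) | exact: (proj1 (L2 _)) |].
move=> h y.
move: a3; apply: scalar_ext; [| exact: (proj2 (L2 _)) | move=> l z].
  by rewrite /conv2 /on_mul; multilinear.
rewrite !conv2_infl_l // /on_mul !crossM !infl_cross !ffunE.
transitivity ((x == 1%g)%:R * (y == 1%g)%:R * (z == 1%g)%:R *
  (c g h * c (g * h)%g l)); first by ring.
by rewrite c_cocycle; ring.
Qed.

(** A nonzero coordinate at (u, w) forces x = y = w, so c(g, h) is compared with c(g^w, h^w), and
    [cJ] applies. *)
Lemma infl_lazy : lazy2 infl_reg2.
Proof.
move=> a1 a2; apply: entryP => u w.
have pL := entry_scalar (k := k) (u, w); have pB := on_mul_biscalar pL.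
transitivity (conv2 (infl c) (on_mul (entry (u, w))) a1 a2).
  exact: scalar_twist.
transitivity (conv2 (on_mul (entry (u, w))) (infl c) a1 a2); last first.
  rewrite scalar_fsw //; apply: eq_sw => a11 a12.
  by rewrite scalar_fsw //; apply: eq_sw => a21 a22; rewrite scalar_fZ // mulrC.
move: a1 a2; apply: biscalar_ext; try exact: conv2_biscalar.
move=> g h x y; rewrite conv2_infl_l // conv2_infl_r // /on_mul entryM !ffunE.
case: (eqVneq x w) => [->|_]; last by rewrite mul0r !(mulr0, mul0r).
case: (eqVneq y w) => [->|_]; last by rewrite !(mulr0, mul0r).
by rewrite cJ mulrC.
Qed.

Lemma infl_beta : trivial_group_H2 (beta_of infl_reg2).
Proof.
by exists b => // g h; rewrite [LHS]infl_cross !ffunE !mul1r.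
Qed.

(** As c(1, 1) = 1, alpha is ε ⊗ ε, the coboundary of the counit. *)
Lemma infl_alpha : trivial_H2 (alpha_of infl_reg2).
Proof.
have [mu muE] := reg1_of (counit_inverse_pair (funalg k G)) (ffunE _ _).
exists mu; apply/coboundaryP => [|f f'].
  split=> f d f1 f2; rewrite /alpha_of cross_linear.
    exact: (proj1 (inflB c)).
  exact: (proj2 (inflB c)).
have cL := @counit_linear k (funalg k G).
rewrite (eq_conv2 (s' := @counit2 k (funalg k G)) (t' := on_mul mu)) //;
  last by move=> f1 f2; rewrite [LHS]infl_cross c1g mulr1.
rewrite conv2_1l ?/tensor; last exact/on_mul_biscalar/scalar_scalar.
by rewrite /on_mul !muE; apply: on_mul_counit.
Qed.

Lemma infl_lambda g x :
  lambda_of infl_reg2 g (dlt k x) = counit (dlt k x).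
Proof.
rewrite lambda_ofE; transitivity (\sum_(t : G) (t == 1%g)%:R * \sum_(y : G)
    (y == 1%g)%:R * \sum_(z : G) (z == 1%g)%:R * dlt k x (y * z)%g); last first.
  by rewrite !sum_delta mulg1.
apply: eq_bigr => t _; rewrite mulr_sumr; apply: eq_bigr => y _.
rewrite !mulr_sumr; apply: eq_bigr => z _.
rewrite [reg2_inv _ _ _]infl_cross [infl_reg2 _ _]infl_cross !ffunE.
by rewrite /c' c1g cg1 invr1; ring.
Qed.

(** A lazy [mu] restricts to a nowhere zero class function with coboundary [c]. It agrees at gh and
    at its conjugate hg, so c(g, h) = c(h, g), and cancelling b(g) b(h) gives b(gh) = b(hg). *)
Lemma infl_not_lazily_trivial g h :
  b (g * h)%g != b (h * g)%g -> ~ trivial_lazy_H2 infl_reg2.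
Proof.
move=> bgh [mu mu_lazy /(coboundaryP mu (inflB c)) muE].
have muL := scalar_scalar mu; have mB := on_mul_biscalar muL.
have muM u v : mu u%:G * mu v%:G = c u v * mu (u * v)%g%:G.
  rewrite -[LHS]muE conv2_one_one //.
  transitivity (\sum_x (x == 1%g)%:R * \sum_y (y == 1%g)%:R *
      (c u v * mu ((u ^ x)%g%:G * (v ^ y)%g%:G))).
    apply: eq_bigr => x _; rewrite mulr_sumr; apply: eq_bigr => y _.
    by rewrite infl_dlt /on_mul; ring.
  by rewrite !sum_delta !conjg1 crossM mulr1.
(* Laziness at [u%:G], read on the coordinate (u, y): one side is mu(u^y × 1), the other does not
   depend on [y]. *)
have muJ u x : mu (u ^ x)%g%:G = mu u%:G.
  have mixB y : biscalar_map (fun a1 a2 => entry (u, y) (mu a1 *: a2)).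
    by split=> v d u1 u2;
      rewrite ?muL !(scalar_fZ (entry_scalar _)) ?(entry_scalar _ d); ring.
  have muJu y :
      \sum_z entry (u, y) (mu (E u z) *: (u ^ z)%g%:G) = mu (u ^ y)%g%:G.
    rewrite -(sw_comul_one u (mixB y)) -(scalar_fsw _ _ (entry_scalar _)).
    rewrite mu_lazy (scalar_fsw _ _ (entry_scalar _)) sw_comul_one; last first.
      by split=> v d u1 u2;
      rewrite ?muL !(scalar_fZ (entry_scalar _)) ?(entry_scalar _ d); ring.
    transitivity (\sum_z (z == y)%:R * mu (u ^ z)%g%:G); last first.
      by rewrite sum_delta.
    apply: eq_bigr => z _; rewrite /entry !ffunE eqxx mul1r.
    exact: mulrC.
  rewrite -muJu -[in RHS](conjg1 u) -muJu; apply: eq_bigr => z _.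
  by rewrite /entry !ffunE.
have mu_neq0 u : mu u%:G != 0.
  have : mu u%:G * mu (u^-1)%g%:G != 0.
    by rewrite muM mulgV [mu _](reg1_unit mu) mulr1.
  by rewrite mulf_eq0 negb_or => /andP[].
have cC : c g h = c h g.
  have hgE : (h * g = (g * h) ^ g)%g by rewrite conjgE mulgA mulKg.
  apply: (mulIf (mu_neq0 (g * h)%g)); rewrite -muM mulrC.
  by rewrite -[in RHS](muJ _ g) -hgE -muM.
case/eqP: bgh; apply/invr_inj/(mulfI (mulf_neq0 (b_neq0 g) (b_neq0 h))).
by rewrite -[LHS]/(c g h) cC /c [b h * b g]mulrC.
Qed.

End CoboundaryInflation.
End Inflation.

(** * The Heisenberg group over F_2 and its commutator form *)

(* (a, b, c) stands for the upper unitriangular matrix over F_2 with entries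
   a, b above the diagonal and c in the corner. *)
Definition heisenberg2 : Type := (bool * bool * bool)%type.
HB.instance Definition _ := Finite.on heisenberg2.

Definition heisenberg2_mul (p q : heisenberg2) : heisenberg2 :=
  let: (a, b, c) := p in let: (a', b', c') := q in
  (a (+) a', b (+) b', c (+) c' (+) (a && b')).

Definition heisenberg2_inv (p : heisenberg2) : heisenberg2 :=
  let: (a, b, c) := p in (a, b, c (+) (a && b)).

Fact heisenberg2_mulA : associative heisenberg2_mul.
Proof. by case=> [[[] []] []] [[[] []] []] [[[] []] []]. Qed.

Fact heisenberg2_mul1 : left_id (false, false, false) heisenberg2_mul.
Proof. by case=> [[[] []] []]. Qed.

Fact heisenberg2_mulV :
  left_inverse (false, false, false) heisenberg2_inv heisenberg2_mul.
Proof. by case=> [[[] []] []]. Qed.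

HB.instance Definition _ := Finite_isGroup.Build heisenberg2
  heisenberg2_mulA heisenberg2_mul1 heisenberg2_mulV.

Definition noncentral_corner (p : heisenberg2) : bool :=
  (p.1.1 || p.1.2) && p.2.

(** The corner entry of the commutator of [p] and [q], which is central. *)
Definition symplectic (p q : heisenberg2) : bool :=
  (p.1.1 && q.1.2) (+) (p.1.2 && q.1.1).

(** Conjugation adds the commutator to the corner; for central [p] both [noncentral_corner] and
    [symplectic] vanish. *)
Lemma noncentral_cornerJ (p q : heisenberg2) :
  noncentral_corner (p ^ q)%g = noncentral_corner p (+) symplectic q p.
Proof. by move: p q => [[[] []] []] [[[] []] []]. Qed.

Lemma symplecticM (p q r : heisenberg2) :
  symplectic r (p * q)%g = symplectic r p (+) symplectic r q.
Proof. by move: p q r => [[[] []] []] [[[] []] []] [[[] []] []]. Qed.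

Theorem lemma5p10 (k : closedFieldType) (char0 : [pchar k] =i pred0) :
  (forall (G : finGroupType) (sigma : reg2 (DGdual k G)),
     lazy_cocycle sigma ->
     trivial_group_H2 (beta_of sigma) ->
     trivial_H2 (alpha_of sigma) ->
     (forall g x : G, lambda_of sigma g (dlt k x) = counit (dlt k x)) ->
     trivial_H2 sigma) /\
  (exists (G : finGroupType) (sigma : reg2 (DGdual k G)),
     [/\ lazy_cocycle sigma,
         trivial_group_H2 (beta_of sigma),
         trivial_H2 (alpha_of sigma),
         forall g x : G, lambda_of sigma g (dlt k x) = counit (dlt k x)
       & ~ trivial_lazy_H2 sigma]).
Proof.
split=> [G sigma [sigmaC sigmaL]|]; first exact: lazy_cocycle_trivial.
pose b (p : heisenberg2) : k := (-1) ^+ noncentral_corner p.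
have b_neq0 p : b p != 0 by rewrite signr_eq0.
have b1 : b 1%g = 1 by [].
have bJ p q : b (p ^ q)%g = b p * (-1) ^+ symplectic q p.
  by rewrite /b noncentral_cornerJ signr_addb.
(* The commutator signs with [r] of [p], [q] and [p * q] cancel, since the sign is
   multiplicative. *)
have cJ p q r : b (p ^ r)%g * b (q ^ r)%g / b ((p ^ r) * (q ^ r))%g =
    b p * b q / b (p * q)%g.
  rewrite -conjMg !bJ symplecticM signr_addb.
  by field; rewrite b_neq0 !signr_eq0.
exists (heisenberg2 : finGroupType); exists (infl_reg2 b_neq0 b1); split.
- by split; [apply: infl_cocycle | apply: infl_lazy].
- exact: infl_beta.
- exact: infl_alpha.
- exact: infl_lambda.
(* The two generators have products (1, 1, 1) and (1, 1, 0), where [b] is -1 and 1; these differ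
   because 2 is nonzero in [k]. *)
apply: (@infl_not_lazily_trivial _ _ _ b_neq0 b1
  (true, false, false) (false, true, false)).
rewrite /b /= expr1 expr0 eq_sym -subr_eq0 opprK.
by have := char0 2; rewrite !inE /= => ->.
Qed.
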